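(* Let $\alpha>1$. For every $v\in\mathfrak X$ the function $$\mathcal K_{\alpha,v}=\sum_{n=0}^{+\infty}d^{\alpha}_{n,h(v)}\,\Gamma^H_{n,v},\qquad\text{where}\qquad d^\alpha_{n,k}:=\Bigl(\sum_{j=0}^{n}q^{-j}\Bigr)b_{k-n-1}^{-1}\quad(n\in\mathbb N,\ k\in\mathbb Z),$$ is the kernel of $\mathcal B^2_\alpha$ associated to $v$, i.e. $\mathcal K_{\alpha,v}\in\mathcal B^2_\alpha$ and $f(v)=\langle f,\mathcal K_{\alpha,v}\rangle$ for all $f\in\mathcal B^2_\alpha$.
   Context: Tree. Let $q\ge 2$ be an integer and let $\mathfrak X$ be (the vertex set of) the $q$-homogeneous tree: the connected graph without cycles in which every vertex has exactly $q+1$ neighbours ($x\sim y$ means $x,y$ are neighbours); $d$ is the edge-counting distance, $\mathbb N=\{0,1,2,\dots\}$. An infinite chain is a sequence $(x_i)_{i\in\mathbb N}$ with $x_i\sim x_{i+1}$ and $x_i\ne x_{i+2}$; two infinite chains $(x_i),(y_j)$ are equivalent if for some $m\in\mathbb Z$ one has $x_i=y_{i+m}$ eventually; a boundary point is an equivalence class. Fix a boundary point $\omega$. For $x\in\mathfrak X$, $[x,\omega)$ is the infinite chain starting at $x$ in the class $\omega$ and $x\wedge y$ is the vertex $z$ with $[x,\omega)\cap[y,\omega)=[z,\omega)$. Vertices $x,y$ lie on the same horocycle if $d(x,x\wedge y)=d(y,x\wedge y)$. Fix a horocycle $H_0$ and, for $k\in\mathbb Z$, let $H_k=\{x: d(x,x\wedge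 y)=d(y,x\wedge y)+k \text{ for some } y\in H_0\}$; the $H_k$ partition $\mathfrak X$. The horocyclic index $h(x)$ is the integer with $x\in H_{h(x)}$. The predecessor $p(x)$ is the only neighbour of $x$ in $H_{h(x)-1}$; the set $S(x)$ of successors consists of the other $q$ neighbours, which lie in $H_{h(x)+1}$; $p^n$ is the $n$-th iterate of $p$ ($p^0=\mathrm{id}$). The horoballs are $HB_n=\bigcup_{j\le n}H_j$. $U_x=\{y:[x,\omega)\subseteq[y,\omega)\}$ is the sector generated by $x$ and $\dot U_x=U_x\setminus\{x\}$. A sum whose starting index exceeds its ending index is $0$. Spaces. $f:\mathfrak X\to\mathbb C$ is harmonic in $x$ if $f(x)=\frac1{q+1}\sum_{y\sim x}f(y)$, harmonic on $Y\subseteq\mathfrak X$ if harmonic in every $x\in Y$, and harmonic if harmonic on $\mathfrak X$. For $\alpha>1$, $\sigma_\alpha(x)=q^{-\alpha h(x)}$, and $\mathcal B^2_\alpha$ is the Hilbert space of harmonic $f:\mathfrak X\to\mathbb C$ with $\sum_{x}|f(x)|^2\sigma_\alpha(x)<\infty$, with inner product $\langle f,g\rangle=\sum_x f(x)\overline{g(x)}\sigma_\alpha(x)$. Harmonic extension. For $n\in\mathbb Z$ and $g:\mathfrak X\to\mathbb C$ harmonic on $HB_n$, $g^H_n:\mathfrak X\to\mathbb C$ is defined by $g^H_n(x)=g(x)$ for $x\in HB_{n+1}$ and, for $x\notin HB_{n+1}$, with $y=p^{h(x)-n-1}(x)$, $$g^H_n(x)=\Bigl(\sum_{j=0}^{h(x)-n-1}q^{-j}\Bigr)g(y)-\Bigl(\sum_{j=1}^{h(x)-n-1}q^{-j}\Bigr)g(p(y)).$$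 The functions $\Gamma$. For $v\in\mathfrak X$ define $\Gamma_v:\mathfrak X\times\mathfrak X\to\mathbb R$ by: $\Gamma_v(x,y)=0$ if $x\notin\dot U_v$ or $y\notin\dot U_v$; $\Gamma_v(x,y)=\frac{q-1}{q}$ if $x,y\in U_z$ for some common $z\in S(v)$; $\Gamma_v(x,y)=-\frac1q$ otherwise. $\Gamma_v(x,\cdot)$ is harmonic on $HB_{h(v)}$. For $n\in\mathbb N$ put $\Gamma_{n,v}=\Gamma_{p^{n+1}(v)}(p^n(v),\cdot)$ and $\Gamma^H_{n,v}=(\Gamma_{n,v})^H_{h(p^{n+1}(v))}$. The constants. For $n\in\mathbb Z$, $b_n=b_{n,\alpha}=q^{-\alpha n}\sum_{l=0}^{+\infty}q^{-\alpha(l+1)}\bigl(\sum_{i=0}^{l}q^{-i}\bigr)\bigl(\sum_{j=0}^{l}q^{j}\bigr)$. *)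

(* Defs.v *)
From HB Require Import structures.
From mathcomp Require Import all_boot all_order all_algebra.
From mathcomp Require Import all_classical all_reals all_analysis.
From mathcomp Require Export complex.

Set Implicit Arguments.
Unset Strict Implicit.
Unset Printing Implicit Defensive.

Import Order.TTheory GRing.Theory Num.Theory.
Import numFieldNormedType.Exports.

Local Open Scope classical_set_scope.
Local Open Scope ring_scope.
Local Open Scope complex_scope.

Section Tree.
Context {X : choiceType}.
Variables (q : nat) (e : rel X).

Record homogeneous_tree : Prop := HomogeneousTree {
  tree_sym : symmetric e ;
  tree_irr : irreflexive e ;
  tree_connected : forall x y, exists s, path e x s /\ last x s = y ;
  tree_acyclic : forall c, (2 < size c)%N -> uniq c -> ~~ path.cycle e c ;
  tree_degree : forall x, ([set y | e x y] #= `I_q.+1)%card }.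

Definition walk (x y : X) : set nat :=
  [set n | exists s, [/\ path e x s, last x s = y & size s = n]].

(* Edge-counting distance; the default 0 is never reached in a connected
   graph. *)
Definition dist (x y : X) : nat :=
  xget 0%N [set n | walk x y n /\ forall m, walk x y m -> (n <= m)%N].

Definition infinite_chain (c : nat -> X) : Prop :=
  forall i, e (c i) (c i.+1) /\ c i != c i.+2.

Definition chain_equiv (c c' : nat -> X) : Prop :=
  exists (m : int) (N : nat), forall i j : nat,
    (N <= i)%N -> j%:Z = i%:Z + m -> c i = c' j.

Definition boundary_point (omega : set (nat -> X)) : Prop :=
  exists c, infinite_chain c /\
    omega = [set c' | infinite_chain c' /\ chain_equiv c c'].

Section Horocycles.
Variable omega : set (nat -> X).

(* In this section every [xget] selects an object which, in a homogeneous tree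
   with boundary point [omega] and horocycle [H0], exists and is unique; the default value given
   to [xget] is irrelevant. *)

Definition ray (x : X) : nat -> X :=
  xget (fun=> x) [set c | omega c /\ c 0%N = x].

Definition confluent (x y : X) : X :=
  xget x [set z | range (ray x) `&` range (ray y) = range (ray z)].

Definition same_horocycle (x y : X) : Prop :=
  dist x (confluent x y) = dist y (confluent x y).

Definition is_horocycle (H : set X) : Prop :=
  exists x, H = [set y | same_horocycle x y].

Definition sector (x : X) : set X := [set y | range (ray x) `<=` range (ray y)].

Definition punctured_sector (x : X) : set X := sector x `\ x.

Variable H0 : set X.

Definition horocycle (k : int) : set X :=
  [set x | exists2 y, H0 y &
     (dist x (confluent x y))%:Z = (dist y (confluent x y))%:Z + k].

Definition hindex (x : X) : int := xget 0 [set k | horocycle k x].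

Definition predecessor (x : X) : X :=
  xget x [set y | e x y /\ horocycle (hindex x - 1) y].

Definition successors (x : X) : set X := [set y | e x y /\ y <> predecessor x].

Definition horoball (n : int) : set X :=
  \bigcup_(j in [set j : int | j <= n]) horocycle j.

Section Functions.
Variable R : realType.
Implicit Types f g : X -> R[i].

Definition harmonic_at f (x : X) : Prop :=
  f x = q.+1%:R^-1 * \sum_(y \in [set y | e x y]) f y.

Definition harmonic_fun f : Prop := forall x, harmonic_at f x.

Variable alpha : R.

Definition bergman_weight (x : X) : R := q%:R `^ (- (alpha * (hindex x)%:~R)).

Definition in_bergman f : Prop :=
  harmonic_fun f /\
  (\esum_(x in [set: X]) (ComplexField.Normc.normc (f x) ^+ 2 * bergman_weight x)%:E
     < +oo)%E.

(* Unordered sum of an absolutely summable family, obtained from sums of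
   nonnegative families; the value is meaningless for other families. *)
Definition real_sum (u : X -> R) : R :=
  fine (\esum_(x in [set: X]) (Num.max (u x) 0)%:E)
  - fine (\esum_(x in [set: X]) (Num.max (- u x) 0)%:E).

Definition complex_sum (u : X -> R[i]) : R[i] :=
  real_sum (fun x => complex.Re (u x)) +i* real_sum (fun x => complex.Im (u x)).

Definition inner f g : R[i] :=
  complex_sum (fun x => f x * (g x)^* * (bergman_weight x)%:C).

Definition is_kernel (v : X) (K : X -> R[i]) : Prop :=
  in_bergman K /\ forall f, in_bergman f -> f v = inner f K.

(* Outside [horoball (n + 1)], [hindex x - n - 1] is positive, so that its
   absolute value [m] is this very integer. *)
Definition hext (n : int) g (x : X) : R[i] :=
  if `[< horoball (n + 1) x >] then g x else
  let m := absz (hindex x - n - 1)%R in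
  let y := iter m predecessor x in
  (\sum_(0 <= j < m.+1) q%:R ^- j)%:C * g y
  - (\sum_(1 <= j < m.+1) q%:R ^- j)%:C * g (predecessor y).

Definition Gamma (v x y : X) : R :=
  if `[< ~ punctured_sector v x \/ ~ punctured_sector v y >] then 0
  else if `[< exists2 z, successors v z & sector z x /\ sector z y >]
  then (q%:R - 1) / q%:R
  else - q%:R^-1.

Definition GammaH (n : nat) (v : X) : X -> R[i] :=
  let u := iter n.+1 predecessor v in
  hext (hindex u) (fun y => (Gamma u (iter n predecessor v) y)%:C).

Definition bcoef (n : int) : R :=
  q%:R `^ (- (alpha * n%:~R)) *
  limn (series (fun l : nat =>
    q%:R `^ (- (alpha * l.+1%:R))
    * (\sum_(0 <= i < l.+1) q%:R ^- i) * (\sum_(0 <= j < l.+1) q%:R ^+ j))).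

Definition dcoef (n : nat) (k : int) : R :=
  (\sum_(0 <= j < n.+1) q%:R ^- j) * (bcoef (k - n%:Z - 1))^-1.

Definition Kterm (v x : X) (n : nat) : R[i] :=
  (dcoef n (hindex v))%:C * GammaH n v x.

(* [R[i]^o] is [R[i]] with the topology of its modulus. *)
Definition Kpartial (v x : X) : nat -> R[i]^o := series (Kterm v x).

Definition Kalpha (v x : X) : R[i] := limn (Kpartial v x).

End Functions.
End Horocycles.
End Tree.

(* Main.v *)
Require Import Defs.
From mathcomp Require Import all_boot all_order all_algebra.
From mathcomp Require Import all_classical all_reals all_analysis.
From mathcomp Require Import finmap ring lra zify.
Import Order.TTheory GRing.Theory Num.Theory.
Import numFieldNormedType.Exports.
Local Open Scope classical_set_scope.
Local Open Scope ring_scope.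

Set Implicit Arguments.
Unset Strict Implicit.
Unset Printing Implicit Defensive.

(** Write $v_n = p^n(v)$, $c_n = \sum_{j\le n} q^{-j}$ and
    $E_n = \sum_{j\le n} q^j$.

    Explicitly, $\Gamma^H_{n,v}$ vanishes off the proper descendants of
    $w = v_{n+1}$, and at a descendant of a child $z$ of $w$, $m$ generations
    below $z$, it equals $c_m([z = v_n] - 1/q)$ ([GammaHE]).  The recurrence
    $(q+1)c_m = q c_{m+1} + c_{m-1}$ makes it harmonic on the whole tree
    ([Gamma_ext_harmonic]).

    For a harmonic $u$, harmonicity summed over a generation is a linear
    recurrence in the depth, whence the sum of $u$ over the descendants of $z$
    at depth $m$ is $E_m u(z) - E_{m-1} u(p(z))$ ([level_sum_harmonic]).  The
    coefficients $[z = v_n] - 1/q$ sum to zero over the children of $w$, so the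
    terms in $u(p(z)) = u(w)$ cancel, and summing over the depths gives
    $\langle u, \Gamma^H_{n,v}\rangle
      = b_{h(v)-n-1}(\delta_n - \delta_{n+1}/q)$
    with $\delta_n = u(v_n) - u(v_{n+1})$; the constant $b$ is exactly the sum
    of the weights $q^{-\alpha(l+1)} c_l E_l$.  Multiplying by $d_{n,h(v)}$
    leaves $c_n(\delta_n - \delta_{n+1}/q)$.  Since $c_{n+1} = 1 + c_n/q$ the
    sum over $n$ telescopes to $u(v)$ minus quantities controlled by
    $u(v_n)$ ([telescoping]), and these tend to 0 because $|u(v_n)|^2$ is at
    most a constant times $q^{-\alpha n}$ when $u$ is square summable
    ([kernel_reproducing]).

    The exchange of the sums over $n$ and over the tree, and the membership of
    the kernel in the space, both come from the bound
    $d_{n,h(v)}^2 \|\Gamma^H_{n,v}\|^2 \le C q^{-\alpha n}$: as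
    $2 q^{-\alpha} < 1$, it survives multiplication by $2^n$
    ([kernel_energy]), which is what Cauchy-Schwarz with weights $2^{-n}$
    asks for.

    The geometry enters only through the predecessor map and the horocyclic
    index.  A boundary point gives one chain from each vertex, because two
    different chains from the same vertex that meet again would close a cycle
    ([chains_same_start]); the predecessor is the second vertex of that chain,
    and the index is computed by counting predecessors up to a common
    ancestor ([exists_height]).

    The kernel is real valued, so a complex harmonic function is treated
    through its real and imaginary parts. *)

(** * Unordered sums of absolutely summable real families *)

Section RealSum.
Context {R : realType}.
Implicit Types I J : choiceType.

Definition abs_summable I (u : I -> R) : Prop :=
  (\esum_(x in [set: I]) `|u x|%:E < +oo)%E.

Lemma esumT_ge0 I (u : I -> R) : (forall x, 0 <= u x) ->
  (0 <= \esum_(x in [set: I]) (u x)%:E)%E.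
Proof. by move=> u0; apply: esum_ge0 => x _; rewrite lee_fin. Qed.

Lemma esum_lty_le I (u a : I -> R) : (forall x, u x <= a x) ->
  (\esum_(x in [set: I]) (a x)%:E < +oo)%E ->
  (\esum_(x in [set: I]) (u x)%:E < +oo)%E.
Proof.
by move=> ua; apply: le_lt_trans; apply: le_esum => x _; rewrite lee_fin.
Qed.

Lemma esum_ge_term I (a : I -> \bar R) x : (forall x, 0 <= a x)%E ->
  (a x <= \esum_(x in [set: I]) a x)%E.
Proof.
move=> a0; apply: esum_ge; exists [set x]; first by split.
by rewrite fsbig_set1.
Qed.

Lemma esum_fibers I J (g : I -> J) (A : set I) (B : set J) (a : I -> \bar R) :
  (forall x, 0 <= a x)%E -> (forall x, A x -> B (g x)) ->
  (\esum_(x in A) a x = \esum_(k in B) \esum_(x in A `&` g @^-1` [set k]) a x)%E.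
Proof.
move=> a0 AB; rewrite (esum_esum (a := fun _ x => a x))//.
apply/esym/(@reindex_esum _ _ _ _ _ (fun x => (g x, x)) (fun k => a k.2)).
split.
- by move=> x Ax; split => //=; exact: AB.
- by move=> x y _ _ [].
- by move=> [k x] /= [Bk [Ax <-]]; exists x.
Qed.

Lemma exchange_esum I J (a : I -> J -> \bar R) :
  (forall i j, 0 <= a i j)%E ->
  (\esum_(i in [set: I]) \esum_(j in [set: J]) a i j =
   \esum_(j in [set: J]) \esum_(i in [set: I]) a i j)%E.
Proof.
move=> a0; rewrite !esum_esum//.
apply: (@reindex_esum _ _ _ _ _ (fun k : J * I => (k.2, k.1))
  (fun k => a k.1 k.2)).
split.
- by move=> [].
- by move=> [i j] [i' j'] _ _ /= [-> ->].
- by move=> [i j] _; exists (j, i).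
Qed.

(** The sum may be computed from any decomposition into summable nonnegative
    families, not only from the positive and negative parts; this is what makes
    it additive and compatible with iterated sums. *)
Lemma real_sum_diff I (u a b : I -> R) :
  (forall x, 0 <= a x) -> (forall x, 0 <= b x) ->
  (forall x, u x = a x - b x) ->
  (\esum_(x in [set: I]) (a x)%:E < +oo)%E ->
  (\esum_(x in [set: I]) (b x)%:E < +oo)%E ->
  real_sum u = fine (\esum_(x in [set: I]) (a x)%:E)
             - fine (\esum_(x in [set: I]) (b x)%:E).
Proof.
move=> a0 b0 uab sa sb.
have p0 x : 0 <= Num.max (u x) 0 by rewrite le_max lexx orbT.
have n0 x : 0 <= Num.max (- u x) 0 by rewrite le_max lexx orbT.
have sp : (\esum_(x in [set: I]) (Num.max (u x) 0)%:E < +oo)%E.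
  apply: esum_lty_le sa => x; rewrite ge_max a0 andbT uab.
  by have := b0 x; lra.
have sn : (\esum_(x in [set: I]) (Num.max (- u x) 0)%:E < +oo)%E.
  apply: esum_lty_le sb => x; rewrite ge_max b0 andbT uab.
  by have := a0 x; lra.
have E : (\esum_(x in [set: I]) (Num.max (u x) 0)%:E
        + \esum_(x in [set: I]) (b x)%:E =
          \esum_(x in [set: I]) (Num.max (- u x) 0)%:E
        + \esum_(x in [set: I]) (a x)%:E)%E.
  rewrite -!esumD; try by move=> x _; rewrite lee_fin.
  apply: eq_esum => x _; rewrite -!EFinD; congr EFin.
  rewrite uab; case: (leP 0 (a x - b x)) => h.
    by rewrite max_r ?oppr_le0//; ring.
  by rewrite max_l ?oppr_ge0 ?ltW//; ring.
have fin (w : I -> R) : (forall x, 0 <= w x) ->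
    (\esum_(x in [set: I]) (w x)%:E < +oo)%E ->
    (\esum_(x in [set: I]) (w x)%:E)%E \is a fin_num.
  by move=> w0 ws; rewrite ge0_fin_numE// esumT_ge0.
move: E; rewrite /real_sum.
rewrite -(fineK (fin _ p0 sp)) -(fineK (fin _ n0 sn)).
rewrite -(fineK (fin _ a0 sa)) -(fineK (fin _ b0 sb)) -!EFinD => -[] /=.
by lra.
Qed.

Lemma pos_neg_part (r : R) : r = Num.max r 0 - Num.max (- r) 0.
Proof.
case: (leP 0 r) => h.
  by rewrite [X in _ - X]max_r ?oppr_le0// subr0.
by rewrite max_l ?opprK ?add0r// oppr_ge0 ltW.
Qed.

Lemma pos_part_le (r : R) : Num.max r 0 <= `|r|.
Proof. by rewrite ge_max ler_norm normr_ge0. Qed.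

Lemma neg_part_le (r : R) : Num.max (- r) 0 <= `|r|.
Proof. by rewrite -normrN; exact: pos_part_le. Qed.

Lemma max0_ge0 (r : R) : 0 <= Num.max r 0.
Proof. by rewrite le_max lexx orbT. Qed.

(** Fubini, reduced to the nonnegative case by [real_sum_diff]. *)
Lemma real_sum_exchange I J (F : I -> J -> R) :
  (\esum_(i in [set: I]) \esum_(j in [set: J]) `|F i j|%:E < +oo)%E ->
  real_sum (fun i => real_sum (F i)) =
  real_sum (fun j => real_sum (fun i => F i j)).
Proof.
(* Both sides are the double sum of the positive parts minus that of the
   negative parts. *)
suff iter_sum I' J' (G : I' -> J' -> R) :
    (\esum_(i in [set: I']) \esum_(j in [set: J']) `|G i j|%:E < +oo)%E ->
    real_sum (fun i => real_sum (G i)) =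
    fine (\esum_(i in [set: I']) \esum_(j in [set: J']) (Num.max (G i j) 0)%:E)
    - fine (\esum_(i in [set: I']) \esum_(j in [set: J'])
        (Num.max (- G i j) 0)%:E).
  move=> sF; rewrite iter_sum// iter_sum; last first.
    by rewrite (exchange_esum (a := fun j i => `|F i j|%:E)).
  by congr (fine _ - fine _); apply: exchange_esum => i j; rewrite lee_fin max0_ge0.
move=> sG.
have part (w : I' -> J' -> R) : (forall i j, 0 <= w i j) ->
    (forall i j, w i j <= `|G i j|) ->
    (forall i, (\esum_(j in [set: J']) (w i j)%:E)%E \is a fin_num) /\
    (\esum_(i in [set: I']) \esum_(j in [set: J']) (w i j)%:E < +oo)%E.
  move=> w0 wG; have ws : (\esum_(i in [set: I']) \esum_(j in [set: J'])
      (w i j)%:E < +oo)%E.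
    apply: le_lt_trans sG; apply: le_esum => i _; apply: le_esum => j _.
    by rewrite lee_fin.
  split => // i; rewrite ge0_fin_numE ?esumT_ge0//.
  apply: le_lt_trans ws.
  by apply: (esum_ge_term (a := fun i => \esum_(j in [set: J']) (w i j)%:E)%E)
    => k; exact: esumT_ge0.
have [Pf Ps] := part _ (fun i j => max0_ge0 (G i j)) (fun i j => pos_part_le _).
have [Nf Ns] := part _ (fun i j => max0_ge0 (- G i j))
  (fun i j => neg_part_le _).
have back (w : I' -> J' -> R) :
    (forall i, (\esum_(j in [set: J']) (w i j)%:E)%E \is a fin_num) ->
    (\esum_(i in [set: I']) (fine (\esum_(j in [set: J']) (w i j)%:E))%:E =
     \esum_(i in [set: I']) \esum_(j in [set: J']) (w i j)%:E)%E.
  by move=> wf; apply: eq_esum => i _; rewrite fineK.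
rewrite -(back _ Pf) -(back _ Nf); apply: real_sum_diff.
- by move=> i; apply: fine_ge0; apply: esumT_ge0 => j; exact: max0_ge0.
- by move=> i; apply: fine_ge0; apply: esumT_ge0 => j; exact: max0_ge0.
- by [].
- by rewrite back.
- by rewrite back.
Qed.

Lemma nonneg_series_cvg (a : nat -> R) : (forall n, 0 <= a n) ->
  (\esum_(n in [set: nat]) (a n)%:E < +oo)%E ->
  series a @ \oo --> fine (\esum_(n in [set: nat]) (a n)%:E)%E.
Proof.
move=> a0 sa.
have e0 n : predT n -> (0 <= (a n)%:E)%E by rewrite lee_fin.
have sm : summable xpredT (EFin \o a).
  rewrite /summable fun_true; apply: le_lt_trans sa.
  by apply: le_esum => n _ /=; rewrite ger0_norm.
have := summable_nneseries_lim e0 sm; have := summable_cvg e0 sm.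
by rewrite nneseries_esumT// => /= cv ->.
Qed.

Lemma abs_summable_series_cvg (u : nat -> R) : abs_summable u ->
  series u @ \oo --> real_sum u.
Proof.
move=> su.
have -> : series u = (fun n => series (fun k => Num.max (u k) 0) n
                             - series (fun k => Num.max (- u k) 0) n).
  apply/funext => n; rewrite /series /= -sumrB.
  by apply: eq_bigr => k _; exact: pos_neg_part.
apply: cvgB; apply: nonneg_series_cvg; try by move=> n; exact: max0_ge0.
- by apply: esum_lty_le su => n; exact: pos_part_le.
- by apply: esum_lty_le su => n; exact: neg_part_le.
Qed.

Lemma real_sum_lim (u : nat -> R) (s : R) : abs_summable u ->
  series u @ \oo --> s -> real_sum u = s.
Proof.
by move=> /abs_summable_series_cvg su us; apply: (cvg_unique _ su us).
Qed.

Lemma abs_summableMr I (u : I -> R) c : abs_summable u ->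
  abs_summable (fun x => u x * c).
Proof.
move=> su; apply: (@le_lt_trans _ _
  (`|c|%:E * \esum_(x in [set: I]) `|u x|%:E)%E); last first.
  by rewrite lte_mul_pinfty// lee_fin.
apply: ge_ereal_sup => _ [A [finA _] <-].
under eq_fsbigr do rewrite normrM mulrC EFinM.
rewrite -ge0_mule_fsumr; last by move=> x; rewrite lee_fin.
apply: lee_wpmul2l; first by rewrite lee_fin.
by apply: esum_ge; exists A.
Qed.

Lemma real_sumMr (a : nat -> R) c : abs_summable a ->
  real_sum (fun n => a n * c) = real_sum a * c.
Proof.
move=> sa; apply: real_sum_lim; first exact: abs_summableMr.
have -> : series (fun n => a n * c) = (fun n => series a n * c).
  by apply/funext => n; rewrite /series /= mulr_suml.
by apply: cvgMl; exact: abs_summable_series_cvg.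
Qed.

Lemma esum_geometric_le (a : nat -> R) (c z : R) : 0 <= z < 1 ->
  (forall n, 0 <= a n <= c * z ^+ n) ->
  (\esum_(n in [set: nat]) (a n)%:E <= (c / (1 - z))%:E)%E.
Proof.
move=> /andP[z0 z1] a_bnd.
have c0 : 0 <= c by have /andP[/le_trans/[apply]] := a_bnd 0%N; rewrite mulr1.
rewrite -nneseries_esumT; last by move=> n; rewrite lee_fin; case/andP: (a_bnd n).
apply: lime_le => [|].
  by apply: is_cvg_nneseries => n _ _; rewrite lee_fin; case/andP: (a_bnd n).
apply: nearW => n; rewrite sumEFin lee_fin.
apply: (@le_trans _ _ (series (geometric c z) n)).
  by apply: ler_sum => k _; case/andP: (a_bnd k).
rewrite geometric_seriesE ?lt_eqF// ler_pM2r ?invr_gt0 ?subr_gt0//.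
by rewrite ler_piMr// gerBl exprn_ge0.
Qed.

Lemma esum_geometric_lty (a : nat -> R) (c z : R) : 0 <= z < 1 ->
  (forall n, 0 <= a n <= c * z ^+ n) ->
  (\esum_(n in [set: nat]) (a n)%:E < +oo)%E.
Proof.
by move=> z01 /(esum_geometric_le z01) /le_lt_trans; apply; exact: ltry.
Qed.

Lemma abs_summable_geometric (u : nat -> R) (c z : R) : 0 <= z < 1 ->
  (forall n, `|u n| <= c * z ^+ n) -> abs_summable u.
Proof.
move=> z01 ub; apply: (esum_geometric_lty (c := c) z01) => n.
by rewrite normr_ge0; exact: ub.
Qed.

Lemma real_sum_norm_le I (u : I -> R) : abs_summable u ->
  (`|real_sum u|%:E <= \esum_(x in [set: I]) `|u x|%:E)%E.
Proof.
move=> su.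
have fin (w : I -> R) : (forall x, 0 <= w x) -> (forall x, w x <= `|u x|) ->
    0 <= fine (\esum_(x in [set: I]) (w x)%:E)
      <= fine (\esum_(x in [set: I]) `|u x|%:E).
  move=> w0 wu; rewrite fine_ge0 ?esumT_ge0//=.
  apply: fine_le; rewrite ?ge0_fin_numE ?esumT_ge0//.
    by apply: esum_lty_le su.
  by apply: le_esum => x _; rewrite lee_fin.
rewrite -[leRHS]fineK ?ge0_fin_numE ?esumT_ge0// lee_fin.
have /andP[p0 pu] := fin _ (fun x => max0_ge0 (u x)) (fun x => pos_part_le _).
have /andP[n0 nu] := fin _ (fun x => max0_ge0 (- u x)) (fun x => neg_part_le _).
by rewrite /real_sum ler_norml; apply/andP; split; lra.
Qed.

Lemma abs_summable_real_sum I J (F : I -> J -> R) :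
  (\esum_(i in [set: I]) \esum_(j in [set: J]) `|F i j|%:E < +oo)%E ->
  abs_summable (fun i => real_sum (F i)).
Proof.
move=> sF; apply: le_lt_trans sF; apply: le_esum => i _.
have [fin|] := ltP (\esum_(j in [set: J]) `|F i j|%:E)%E +oo%E.
  exact: real_sum_norm_le.
by rewrite leye_eq => /eqP ->; exact: leey.
Qed.

(** Cauchy-Schwarz against the weights $2^{-n-1}$, whose sum is at most 1. *)
Lemma sqr_sum_le_weighted (a : nat -> R) n :
  (\sum_(0 <= k < n) a k) ^+ 2 <= \sum_(0 <= k < n) 2 ^+ k.+1 * a k ^+ 2.
Proof.
elim: n a => [|n IH] a; first by rewrite !big_nil expr0n.
rewrite !big_nat_recl//=.
have -> : \sum_(0 <= k < n) 2 ^+ k.+2 * a k.+1 ^+ 2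
    = 2 * \sum_(0 <= k < n) 2 ^+ k.+1 * a k.+1 ^+ 2.
  by rewrite mulr_sumr; apply: eq_bigr => k _; rewrite (exprS _ k.+1) mulrA.
have /= := IH (fun k => a k.+1).
move: (\sum_(0 <= k < n) a k.+1) => s; move: (\sum_(0 <= k < n) _) => t st.
by have := sqr_ge0 (a 0%N - s); rewrite expr1; lra.
Qed.

Lemma sqr_real_sum_le_weighted (a : nat -> R) : abs_summable a ->
  ((real_sum a ^+ 2)%:E <=
   \esum_(n in [set: nat]) (2 ^+ n.+1 * a n ^+ 2)%:E)%E.
Proof.
move=> /abs_summable_series_cvg ca.
have t0 n : 0 <= 2 ^+ n.+1 * a n ^+ 2.
  by apply: mulr_ge0; rewrite ?sqr_ge0// exprn_ge0.
set T := (\esum_(n in [set: nat]) (2 ^+ n.+1 * a n ^+ 2)%:E)%E.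
have [fin|] := ltP T +oo%E; last by rewrite leye_eq => /eqP ->; exact: leey.
have ct := nonneg_series_cvg t0 fin.
rewrite -[leRHS]fineK ?ge0_fin_numE ?esumT_ge0// lee_fin.
have c2 : (series a n) ^+ 2 @[n --> \oo] --> real_sum a ^+ 2.
  by under eq_fun do rewrite expr2; rewrite expr2; apply: cvgM.
rewrite -(cvg_lim _ c2)// -(cvg_lim _ ct)//.
apply: ler_lim; [exact: cvgP c2|exact: cvgP ct|].
by apply: nearW => n; exact: sqr_sum_le_weighted.
Qed.
End RealSum.

(** * Chains in a tree *)

Section Chains.
Context {X : choiceType}.
Variables (q : nat) (e : rel X).
Hypothesis treeX : homogeneous_tree q e.
Implicit Types c : nat -> X.

(** [mkseq (c \o S) n] lists the vertices of [c] after the first one, so that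
    [c 0] followed by it is a path in the format of [path]. *)
Lemma last_mkseqS c n : last (c 0%N) (mkseq (c \o S) n) = c n.
Proof. by case: n => [//|n]; rewrite mkseqS last_rcons. Qed.

Lemma path_mkseqS c n : (forall k, (k < n)%N -> e (c k) (c k.+1)) ->
  path e (c 0%N) (mkseq (c \o S) n).
Proof.
elim: n => [//|n IH] ec; rewrite mkseqS rcons_path last_mkseqS ec// andbT.
by apply: IH => k kn; apply: ec; rewrite ltnS ltnW.
Qed.

Lemma infinite_chain_shift c n :
  infinite_chain e c -> infinite_chain e (fun k => c (n + k)%N).
Proof. by move=> cc k; rewrite !addnS; exact: cc. Qed.

(** A first return would close a cycle: returns after one or two steps are
    excluded by irreflexivity and by the absence of backtracking, and a shortest
    longer one has distinct vertices. *)
Lemma infinite_chain_inj c : infinite_chain e c -> injective c.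
Proof.
move=> cc.
suff neq d : forall i, (0 < d)%N -> c i <> c (i + d)%N.
  move=> i j cij; case: (ltngtP i j) => // ij; exfalso.
    by apply: (neq (j - i)%N i); [rewrite subn_gt0|rewrite (subnKC (ltnW ij))].
  by apply: (neq (i - j)%N j); [rewrite subn_gt0|rewrite (subnKC (ltnW ij))].
elim/ltn_ind: d => d IH i d0 cid.
have [d2|d2] := leqP d 2.
  have [eq1|eq2] : d = 1%N \/ d = 2%N by lia.
    by have [] := cc i; rewrite -addn1 -eq1 -cid (tree_irr treeX).
  by have [_] := cc i; rewrite -addn2 -eq2 -cid eqxx.
pose s := mkseq (fun k => c (i + k)%N) d.
have us : uniq s.
  apply/mkseq_uniqP => k l; rewrite !inE => kd ld ckl.
  case: (ltngtP k l) => // kl; exfalso.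
    apply: (IH (l - k)%N _ (i + k)%N); [lia|lia|].
    by rewrite -addnA subnKC// ltnW.
  apply: (IH (k - l)%N _ (i + l)%N); [lia|lia|].
  by rewrite -addnA subnKC// ltnW.
have ss : size s = d by rewrite size_mkseq.
have := tree_acyclic treeX _ us; rewrite ss => /(_ d2)/negP; apply.
have -> : s = c i :: mkseq ((fun k => c (i + k)%N) \o S) d.-1.
  rewrite /s /mkseq; case: d d0 {IH cid d2 s us ss} => // d _ /=.
  by rewrite addn0 (iotaDl 1 0) -map_comp.
rewrite /path.cycle.
have -> : rcons (mkseq ((fun k => c (i + k)%N) \o S) d.-1) (c i)
    = mkseq ((fun k => c (i + k)%N) \o S) d.
  by rewrite -[X in _ = mkseq _ X](prednK d0) mkseqS /= (prednK d0) -cid.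
have := @path_mkseqS (fun k => c (i + k)%N) d; rewrite addn0; apply => k _.
by rewrite addnS; case: (cc (i + k)%N).
Qed.

(** If the chains left their common origin along different edges, follow [c] up
    to its first vertex on [c'] and come back along [c']: this is a cycle. *)
Lemma chains_same_start c c' a b : infinite_chain e c -> infinite_chain e c' ->
  c 0%N = c' 0%N -> (0 < a)%N -> (0 < b)%N -> c a = c' b -> c 1%N = c' 1%N.
Proof.
move=> cc cc' c00 a0 b0 cab; apply: contrapT => c11.
pose P n := (0 < n)%N && `[< exists2 b, (0 < b)%N & c n = c' b >].
have exP : exists n, P n by exists a; rewrite /P a0; apply/asboolP; exists b.
(* [a] becomes the first positive index at which [c] meets [c'] again. *)
case: (ex_minnP exP) => {cab a0 b0}{}a {}/andP[a0 /asboolP[{}b b0 cab]] amin.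
have ic := infinite_chain_inj cc; have ic' := infinite_chain_inj cc'.
pose s := mkseq c a.+1 ++ rev (mkseq (c' \o S) b.-1).
have us : uniq s.
  rewrite cat_uniq mkseq_uniq// rev_uniq mkseq_uniq; last first.
    by move=> k l /ic' [].
  rewrite andbT; apply/hasPn => z; rewrite mem_rev => /mapP[k + ->] /=.
  rewrite mem_iota add0n => /andP[_ kb].
  apply/negP => /mapP[i ]; rewrite mem_iota add0n ltnS => /andP[_ ia] /= cki.
  case: (posnP i) => [i0|i0]; first by move: cki; rewrite i0 c00 => /ic'.
  move: ia; rewrite leq_eqVlt => /orP[/eqP ia|ia].
    by move: cki; rewrite ia cab => /ic'; lia.
  suff /amin : P i by rewrite leqNgt ia.
  by rewrite /P i0; apply/asboolP; exists k.+1.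
have ss : (2 < size s)%N.
  rewrite size_cat size_rev !size_mkseq.
  have : ~ (a = 1%N /\ b = 1%N) by move=> [a1 b1]; apply: c11; rewrite -{1}a1 -b1.
  lia.
have := tree_acyclic treeX ss us; apply/negP/negPn.
have bel : c' 0%N :: mkseq (c' \o S) b.-1
    = belast (c' 0%N) (mkseq (c' \o S) b).
  by rewrite -{2}(prednK b0) mkseqS belast_rcons.
have -> : s = c 0%N :: mkseq (c \o S) a ++ rev (mkseq (c' \o S) b.-1).
  rewrite /s /mkseq /=; congr (_ :: (_ ++ _)).
  by rewrite (iotaDl 1 0) -map_comp.
rewrite /path.cycle rcons_cat cat_path path_mkseqS/= => [|k _]; last first.
  by case: (cc k).
rewrite last_mkseqS cab {1}c00 -rev_cons bel -[c' b]last_mkseqS rev_path.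
rewrite (eq_path (e' := e)) => [|x y]; last exact: tree_sym treeX _ _.
by apply: path_mkseqS => k _; case: (cc' k).
Qed.

End Chains.

(** * The rays towards a boundary point *)

Section Boundary.
Context {X : choiceType}.
Variables (q : nat) (e : rel X) (omega : set (nat -> X)).
Hypothesis treeX : homogeneous_tree q e.
Hypothesis bdX : boundary_point e omega.
Implicit Types c : nat -> X.

Lemma omega_chain c : omega c -> infinite_chain e c.
Proof. by have [c0 [_ ->]] := bdX; case. Qed.

(** The bound [N] is needed because uniqueness of rays is proved by comparing
    tails, which must still meet. *)
Lemma omega_meet c c' N : omega c -> omega c' ->
  exists a b, [/\ (N <= a)%N, (N <= b)%N & c a = c' b].
Proof.
have [c0 [_ ->]] := bdX => -[_ [m [M cM]]] [_ [m' [M' cM']]].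
pose i := (N + M + M' + `|m| + `|m'|)%N.
have ja : (absz (i%:Z + m)) = i%:Z + m :> int by rewrite /i; lia.
have jb : (absz (i%:Z + m')) = i%:Z + m' :> int by rewrite /i; lia.
exists (absz (i%:Z + m)), (absz (i%:Z + m')); split.
- by rewrite /i; lia.
- by rewrite /i; lia.
- by rewrite -(cM i)// -?(cM' i)// /i; lia.
Qed.

Lemma omega_uniq c c' : omega c -> omega c' -> c 0%N = c' 0%N -> c = c'.
Proof.
move=> oc oc' c00; apply/funext; elim=> [//|n IH].
have [a [b [na nb cab]]] := omega_meet n.+1 oc oc'.
have := @chains_same_start _ _ _ treeX (fun k => c (n + k)%N)
  (fun k => c' (n + k)%N) (a - n)%N (b - n)%N.
rewrite addn0 addn1; apply; rewrite ?addn0 ?subn_gt0//.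
- by apply: infinite_chain_shift; exact: omega_chain.
- by apply: infinite_chain_shift; exact: omega_chain.
- by rewrite !subnKC// ltnW.
Qed.

Lemma omega_tail c : omega c -> omega (c \o S).
Proof.
have [c0 [_ ->]] := bdX => -[cc [m [N cN]]]; split.
  exact: (infinite_chain_shift 1 cc).
by exists (m - 1), N => i j Ni jm /=; apply: cN => //; lia.
Qed.

Lemma omega_cons c x : omega c -> e x (c 0%N) -> x != c 1%N ->
  omega (fun n => if n is k.+1 then c k else x).
Proof.
have [c0 [_ ->]] := bdX => -[cc [m [N cN]]] xc xc1; split.
  by case=> [|i]; [split|exact: cc].
exists (m + 1), (N + `|m|)%N => i [|j] Ni jm; first by lia.
by apply: cN; lia.
Qed.

(** A ray from [x] is obtained by walking from a chain of the class to [x] one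
    edge at a time: each edge either prolongs the chain backwards or, when it
    retraces its first edge, shortens it. *)
Lemma omega_ray x : omega (ray omega x) /\ ray omega x 0%N = x.
Proof.
apply: (@xgetPex _ (fun=> x) [set c | omega c /\ c 0%N = x]).
have [c0 [cc0 om]] := bdX.
have oc0 : omega c0.
  by rewrite om; split=> //; exists 0, 0%N => i j _; rewrite addr0 => -[->].
have [s [xs lst]] := tree_connected treeX x (c0 0%N).
elim: s x xs lst => [|y s IH] x /=; first by move=> _ ->; exists c0.
move=> /andP[exy ys] /(IH _ ys)[c [oc c0y]].
have [xc1|xc1] := eqVneq x (c 1%N).
  by exists (c \o S); split; [exact: omega_tail|].
exists (fun n => if n is k.+1 then c k else x); split=> //.
by apply: omega_cons => //; rewrite c0y.
Qed.

(** This map is shown in [predecessorE] to be the predecessor; it is available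
    before any horocycle is chosen. *)
Definition parent x := ray omega x 1%N.

Lemma ray_iter x n : ray omega x n = iter n parent x.
Proof.
elim: n x => [x|n IH x]; first by case: (omega_ray x).
rewrite iterSr -IH; have [ox _] := omega_ray x; have [op p0] := omega_ray (parent x).
by rewrite -[LHS]/((ray omega x \o S) n) (omega_uniq (omega_tail ox) op).
Qed.

Lemma iter_parent_inj x : injective (fun n => iter n parent x).
Proof.
move=> m n; rewrite -!ray_iter; apply: infinite_chain_inj; first exact: treeX.
by apply: omega_chain; case: (omega_ray x).
Qed.

Lemma parent_confluence x y : exists m n, iter m parent x = iter n parent y.
Proof.
have [a [b [_ _]]] := omega_meet 0 (omega_ray x).1 (omega_ray y).1.
by rewrite !ray_iter => ab; exists a, b.
Qed.

Lemma edge_parent x : e x (parent x).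
Proof.
have [ox x0] := omega_ray x; have [] := omega_chain ox 0.
by rewrite x0.
Qed.

(** If [y] is not the parent of [x], putting [y] in front of the ray of [x]
    gives a chain, which by uniqueness is the ray of [y]. *)
Lemma edgeE x y : e x y = (y == parent x) || (x == parent y).
Proof.
apply/idP/orP => [exy|[]/eqP->]; last 2 first.
- exact: edge_parent.
- by rewrite (tree_sym treeX) edge_parent.
have [->|yp] := eqVneq y (parent x); [by left|right].
have [ox x0] := omega_ray x.
have oy : omega (fun n => if n is k.+1 then ray omega x k else y).
  by apply: omega_cons; rewrite ?x0// (tree_sym treeX).
have [ory y0] := omega_ray y.
by rewrite /parent (omega_uniq ory oy)//= x0.
Qed.

(** Reducing a walk to one that first ascends and then descends does not
    lengthen it. *)
Lemma walk_parents x y n : walk e x y n ->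
  exists a b, (a + b <= n)%N /\ iter a parent x = iter b parent y.
Proof.
move=> [s [xs lst <-]]; elim: s x xs lst => [|z s IH] x /=.
  by move=> _ ->; exists 0%N, 0%N.
rewrite edgeE => /andP[xz zs] /(IH _ zs)[a [b [ab eab]]].
case/orP: xz => /eqP xz.
  exists a.+1, b; split; first by rewrite addSn ltnS.
  by rewrite iterSr -xz.
case: a ab eab => [|a] ab eab.
  exists 0%N, b.+1; split; first by rewrite addnS ltnS.
  by rewrite xz /= -eab.
exists a, b; split; first by rewrite ltnW// ltnS ltnW.
by rewrite xz -eab iterSr.
Qed.

Lemma dist_iter_parent x n : dist e x (iter n parent x) = n.
Proof.
have wn : walk e x (iter n parent x) n.
  exists (mkseq ((fun k => iter k parent x) \o S) n); split.
  - apply: (path_mkseqS (c := fun k => iter k parent x)) => k _.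
    exact: edge_parent.
  - exact: (last_mkseqS (fun k => iter k parent x)).
  - by rewrite size_mkseq.
have wmin m : walk e x (iter n parent x) m -> (n <= m)%N.
  move=> /walk_parents[a [b [abm]]]; rewrite -iterD => /iter_parent_inj.
  lia.
have [wd dmin] : walk e x (iter n parent x) (dist e x (iter n parent x)) /\
    forall m, walk e x (iter n parent x) m ->
      (dist e x (iter n parent x) <= m)%N.
  apply: (@xgetPex _ 0%N [set k | walk e x (iter n parent x) k /\
    forall m, walk e x (iter n parent x) m -> (k <= m)%N]).
  by exists n; split.
by apply/eqP; rewrite eqn_leq wmin// dmin.
Qed.

(** The confluent is the first vertex of the ray of [x] on the ray of [y]. *)
Lemma confluentE x y : exists m n, [/\ confluent omega x y = iter m parent x,
  confluent omega x y = iter n parent y & iter m parent x = iter n parent y].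
Proof.
have [E|] := pselect (exists z, range (ray omega x) `&` range (ray omega y) =
    range (ray omega z)).
  have := xgetPex x E; rewrite -/(confluent omega x y) /=.
  set z := confluent omega x y => zE.
  have : range (ray omega z) z by exists 0%N => //; case: (omega_ray z).
  rewrite -zE => -[[m _ xm] [n _ yn]].
  by exists m, n; rewrite -!ray_iter xm yn.
case; pose P m := `[< exists n, iter m parent x = iter n parent y >].
have exP : exists m, P m.
  have [m [n mn]] := parent_confluence x y.
  by exists m; apply/asboolP; exists n.
case: (ex_minnP exP) => m /asboolP[n mn] mmin.
exists (iter m parent x); apply/seteqP; split => w.
  move=> [[i _ xi] [j _ yj]].
  have mi : (m <= i)%N.
    by apply: mmin; apply/asboolP; exists j; rewrite -!ray_iter xi yj.
  exists (i - m)%N => //.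
  by rewrite -xi !ray_iter -iterD subnK.
move=> [i _ <-]; split; first by exists (i + m)%N; rewrite // !ray_iter iterD.
by exists (i + n)%N; rewrite // !ray_iter iterD -mn.
Qed.

End Boundary.

(** * Horocyclic index, predecessors and sectors *)

Section Horocyclic.
Context {X : choiceType}.
Variables (q : nat) (e : rel X) (omega : set (nat -> X)) (H0 : set X).
Hypothesis treeX : homogeneous_tree q e.
Hypothesis bdX : boundary_point e omega.
Hypothesis horX : is_horocycle e omega H0.

Local Notation p := (predecessor e omega H0).
Local Notation h := (hindex e omega H0).

(** The height of [x] is $m - n$ when the $m$-th ancestor of [x] is the $n$-th
    ancestor of an origin [z0] on $H_0$; injectivity of rays makes it well
    defined, and distances to the confluent compute it. *)
Lemma exists_height : exists ht : X -> int,
  [/\ forall k x, horocycle e omega H0 k x <-> ht x = k &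
      forall x, ht (parent omega x) = ht x - 1].
Proof.
set f := parent omega.
have [z0 H0E] := horX.
pose Q x (k : int) := exists m n, iter m f x = iter n f z0 /\ k = m%:Z - n%:Z.
have Qex x : exists k, Q x k.
  have [m [n mn]] := parent_confluence treeX bdX x z0.
  by exists (m%:Z - n%:Z), m, n.
pose ht (x : X) : int := xget (0 : int) (Q x).
have htE m n x y : iter m f x = iter n f y -> ht x - m%:Z = ht y - n%:Z.
  have [a [b [ab hx]]] := xgetPex (0 : int) (Qex x).
  have [a' [b' [ab' hy]]] := xgetPex (0 : int) (Qex y).
  rewrite /ht hx hy => mn.
  have : iter (a' + m + b) f z0 = iter (a + n + b') f z0.
    transitivity (iter (a + a' + m) f x).
      by rewrite iterD -ab -iterD; congr iter; lia.
    rewrite [LHS]iterD mn -iterD [RHS]iterD -ab' -iterD; congr iter; lia.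
  by move=> /(iter_parent_inj treeX bdX); lia.
have conf x y : exists m n, [/\ dist e x (confluent omega x y) = m,
    dist e y (confluent omega x y) = n & ht x - m%:Z = ht y - n%:Z].
  have [m [n [xm yn mn]]] := confluentE treeX bdX x y.
  exists m, n; split; last exact: htE.
  - by rewrite xm (dist_iter_parent treeX bdX).
  - by rewrite yn (dist_iter_parent treeX bdX).
have H0ht y : H0 y <-> ht y = ht z0.
  rewrite H0E /= /same_horocycle; have [m [n [-> -> hmn]]] := conf z0 y.
  by split => H; lia.
have ht0 : ht z0 = 0.
  have [a [b [ab hz]]] := xgetPex (0 : int) (Qex z0); rewrite /ht hz.
  by move/(iter_parent_inj treeX bdX): ab; lia.
exists ht; split=> [k x|x].
  split=> [[y /H0ht y0]|xk].
    have [m [n [-> -> hmn]]] := conf x y.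
    by move: y0 hmn; rewrite ht0; lia.
  exists z0; first exact/H0ht.
  have [m [n [-> -> hmn]]] := conf x z0.
  by move: hmn; rewrite ht0; lia.
by have := @htE 0%N 1%N (f x) x erefl; rewrite subr0.
Qed.

Lemma horocycleE k x : horocycle e omega H0 k x <-> h x = k.
Proof.
have [ht [htE _]] := exists_height.
have hE y : h y = ht y.
  apply: xget_unique; first exact/htE.
  by move=> k' /htE.
by rewrite hE.
Qed.

Lemma hindex_parent x : h (parent omega x) = h x - 1.
Proof.
have [ht [htE htp]] := exists_height.
have hE y : h y = ht y by apply/esym/htE/horocycleE.
by rewrite !hE.
Qed.

Lemma predecessorE x : p x = parent omega x.
Proof.
apply: xget_unique.
  split; first exact: (edge_parent treeX bdX).
  by apply/horocycleE; rewrite hindex_parent.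
move=> y [exy /horocycleE hy].
move: exy; rewrite (edgeE treeX bdX) => /orP[/eqP//|/eqP xy].
by move: hy; rewrite xy hindex_parent; lia.
Qed.

Lemma hindex_predecessor x : h (p x) = h x - 1.
Proof. by rewrite predecessorE hindex_parent. Qed.

Lemma edge_predecessorE x y : e x y = (y == p x) || (x == p y).
Proof. by rewrite !predecessorE; exact: (edgeE treeX bdX). Qed.

Lemma successorsE x y : successors e omega H0 x y <-> p y = x.
Proof.
rewrite /successors /= edge_predecessorE; split.
  by move=> [/orP[/eqP yp|/eqP xp] ynp]; [case: ynp|rewrite xp].
move=> <-; rewrite eqxx orbT; split=> // yp.
by have := congr1 h yp; rewrite !hindex_predecessor; lia.
Qed.

Lemma sectorE x y : sector omega x y <-> exists n, iter n p y = x.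
Proof.
have rE z n : ray omega z n = iter n p z.
  rewrite (ray_iter treeX bdX); elim: n => //= n ->.
  by rewrite predecessorE.
split=> [xy|[n yx] _ [m _ <-]].
  have [|n _] := xy x; last by rewrite rE; exists n.
  by exists 0%N; rewrite // rE.
by exists (m + n)%N; rewrite // !rE iterD yx.
Qed.

Lemma horoballE n x : horoball e omega H0 n x <-> (h x <= n).
Proof.
split=> [[k /= kn /horocycleE->//]|hn].
by exists (h x) => //; exact/horocycleE.
Qed.

Lemma exists_children : exists ch : X -> seq X,
  [/\ forall x, uniq (ch x), forall x y, (y \in ch x) = (p y == x) &
      forall x, size (ch x) = q].
Proof.
suff H x : exists s : seq X, [/\ uniq s, forall y, (y \in s) = (p y == x)
    & size s = q].
  have [ch chP] := choice H; exists ch; split=> x; have [us ms ss] := chP x.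
  - exact: us.
  - exact: ms.
  - exact: ss.
have nbrs := tree_degree treeX x; set A := [set y | e x y] in nbrs.
have finA : finite_set A by apply/finite_setP; exists q.+1.
have memA y : (y \in fset_set A) = e x y.
  rewrite in_fset_set//; apply/idP/idP => [/set_mem//|exy]; exact/mem_set.
have px : p x \in fset_set A by rewrite memA edge_predecessorE eqxx.
exists (rem (p x) (fset_set A)); split.
- by rewrite rem_uniq.
- move=> y; rewrite mem_rem_uniq// inE memA edge_predecessorE [x == _]eq_sym.
  have excl (b c : bool) : (b -> c = false) -> ~~ b && (b || c) = c.
    by case: b => // /(_ isT) ->.
  apply: excl => /eqP->; apply/eqP => ppx; have := congr1 h ppx.
  by rewrite !hindex_predecessor; lia.
- by rewrite size_rem// (card_fset_set nbrs).
Qed.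

End Horocyclic.

(** * Truncated geometric series *)

Section Geometric.
Context {R : realType}.
Variable q : nat.
Hypothesis q_ge2 : (2 <= q)%N.

(** [inv_geo n] has $n+1$ terms and [geo n] has $n$: the second vanishes at 0,
    which spares a special case at depth 0 in [level_sum_harmonic]. *)
Definition inv_geo n : R := \sum_(0 <= j < n.+1) q%:R ^- j.
Definition geo n : R := \sum_(0 <= j < n) q%:R ^+ j.

Lemma q_ge2R : 2 <= q%:R :> R.
Proof. by rewrite (ler_nat _ 2). Qed.

Lemma q_gt0R : 0 < q%:R :> R.
Proof. by have := q_ge2R; lra. Qed.

Lemma q_neq0 : q%:R != 0 :> R.
Proof. by rewrite gt_eqF// q_gt0R. Qed.

Lemma inv_geo0 : inv_geo 0 = 1.
Proof. by rewrite /inv_geo big_nat1 expr0 invr1. Qed.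

Lemma inv_geoS n : inv_geo n.+1 = 1 + q%:R^-1 * inv_geo n.
Proof.
rewrite /inv_geo big_nat_recl// expr0 invr1 mulr_sumr; congr (_ + _).
by apply: eq_bigr => j _; rewrite exprS invfM.
Qed.

Lemma inv_geo_ge1 n : 1 <= inv_geo n.
Proof.
elim: n => [|n IH]; first by rewrite inv_geo0.
by rewrite inv_geoS lerDl mulr_ge0 ?invr_ge0 ?ler0n// (le_trans ler01).
Qed.

Lemma inv_geo_le2 n : inv_geo n <= 2.
Proof.
elim: n => [|n IH]; first by rewrite inv_geo0; lra.
have : q%:R^-1 * inv_geo n <= 2^-1 * 2.
  apply: ler_pM => //; rewrite ?invr_ge0 ?ler0n ?(le_trans ler01 (inv_geo_ge1 n))//.
  by rewrite lef_pV2 ?posrE ?q_gt0R// q_ge2R.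
by rewrite inv_geoS; lra.
Qed.

Lemma geo0 : geo 0 = 0.
Proof. by rewrite /geo big_nil. Qed.

Lemma geoS n : geo n.+1 = geo n + q%:R ^+ n.
Proof. by rewrite /geo big_nat_recr. Qed.

Lemma geo_ge0 n : 0 <= geo n.
Proof. by apply: sumr_ge0 => j _; rewrite exprn_ge0// ltW// q_gt0R. Qed.

Lemma geo_ind2 n : geo n.+2 = (q%:R + 1) * geo n.+1 - q%:R * geo n.
Proof. by rewrite !geoS exprS; ring. Qed.

Lemma geo_le n : geo n <= q%:R ^+ n.
Proof.
elim: n => [|n IH]; first by rewrite geo0 expr0.
rewrite geoS exprS; have := q_ge2R; have : 0 < q%:R ^+ n :> R.
  by rewrite exprn_gt0// q_gt0R.
by move: IH; move: (q%:R ^+ n) (geo n) => a b; nra.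
Qed.

End Geometric.

(** * Real harmonic functions along generations *)

Section Descent.
Context {R : realType} {X : choiceType}.
Variables (q : nat) (p : X -> X) (h : X -> int) (ch : X -> seq X).
Hypothesis hp : forall x, h (p x) = h x - 1.
Implicit Types (u F : X -> R).

Lemma height_iter n x : h (iter n p x) = h x - n%:Z.
Proof. by elim: n => [|n IH]; rewrite ?subr0// iterS hp IH; lia. Qed.

Lemma height_descendant m x w : iter m p x = w -> h x = h w + m%:Z.
Proof. by move=> <-; rewrite height_iter; lia. Qed.

Hypothesis q_ge2 : (2 <= q)%N.
Hypothesis ch_uniq : forall x, uniq (ch x).
Hypothesis mem_ch : forall x y, (y \in ch x) = (p y == x).
Hypothesis size_ch : forall x, size (ch x) = q.

Definition tree_harmonic u :=
  forall x, (q%:R + 1) * u x = u (p x) + \sum_(y <- ch x) u y.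

Lemma sum_ch_const (c : R) z : \sum_(y <- ch z) c = q%:R * c.
Proof. by rewrite big_const_seq count_predT size_ch iter_addr_0 mulr_natl. Qed.

(** The recursion on generations turns harmonicity into a recurrence in [m];
    [esum_level] identifies the value with the sum over the vertices whose
    [m]-th ancestor is [z]. *)
Fixpoint level_sum m F z : R :=
  if m is m'.+1 then \sum_(y <- ch z) level_sum m' F y else F z.

Lemma level_sum_eqM m F F' c z :
  (forall x, iter m p x = z -> F x = c * F' x) ->
  level_sum m F z = c * level_sum m F' z.
Proof.
elim: m z => [|m IH] z FF' /=; first exact: FF'.
rewrite mulr_sumr big_seq [RHS]big_seq; apply: eq_bigr => y.
rewrite mem_ch => /eqP yz; apply: IH => x xy; apply: FF'.
by rewrite iterS xy.
Qed.

Lemma level_sum_const m c z : level_sum m (fun=> c) z = q%:R ^+ m * c.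
Proof.
elim: m z => [|m IH] z /=; first by rewrite mul1r.
under eq_bigr do rewrite IH.
by rewrite sum_ch_const exprS mulrA.
Qed.

Lemma level_sum_sub m F F' z :
  level_sum m (fun x => F x - F' x) z = level_sum m F z - level_sum m F' z.
Proof.
elim: m z => [//|m IH] z /=; rewrite -sumrB.
by apply: eq_bigr => y _; rewrite IH.
Qed.

Lemma level_sum_ge0 m F z : (forall x, 0 <= F x) -> 0 <= level_sum m F z.
Proof.
by move=> F0; elim: m z => [//|m IH] z /=; apply: sumr_ge0 => y _.
Qed.

(** Summing $(q+1)u = u\circ p + \sum_{ch} u$ over a generation gives a
    recurrence of order two in [m], whose solutions are spanned by 1 and
    $q^m$. *)
Lemma level_sum_harmonic u m z : tree_harmonic u ->
  level_sum m u z = geo q m.+1 * u z - geo q m * u (p z).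
Proof.
move=> hu; elim: m z => [|m IH] z /=.
  by rewrite geoS geo0 expr0; ring.
have -> : \sum_(y <- ch z) level_sum m u y =
    geo q m.+1 * (\sum_(y <- ch z) u y) - q%:R * (geo q m * u z).
  rewrite -(sum_ch_const _ z) mulr_sumr -sumrB big_seq [RHS]big_seq.
  by apply: eq_bigr => y; rewrite mem_ch IH => /eqP->.
have -> : \sum_(y <- ch z) u y = (q%:R + 1) * u z - u (p z).
  by rewrite hu; ring.
by rewrite (geo_ind2 _ m); ring.
Qed.

Lemma esum_level m F z : (forall x, 0 <= F x) ->
  (\esum_(x in [set x | iter m p x = z]) (F x)%:E = (level_sum m F z)%:E)%E.
Proof.
move=> F0; have F0e x : (0 <= (F x)%:E)%E by rewrite lee_fin.
elim: m z => [|m IH] z /=.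
  exact: (esum_set1 (F0e z)).
rewrite (esum_fibers (g := iter m p) (B := [set` ch z]))//; last first.
  by move=> x /= <-; rewrite mem_ch.
have -> : (\esum_(y in [set` ch z])
     \esum_(x in [set x | p (iter m p x) = z] `&` iter m p @^-1` [set y])
     (F x)%:E = \esum_(y in [set` ch z]) (level_sum m F y)%:E)%E.
  apply: eq_esum => y /=; rewrite mem_ch => /eqP yz; rewrite -IH.
  congr esum; apply/seteqP; split=> x /=; first by case.
  by move=> xy; rewrite xy.
rewrite esum_fset.
- by rewrite -fsbig_seq// sumEFin.
- exact: finite_seq.
- by move=> y _; rewrite lee_fin level_sum_ge0.
Qed.

(** The depth below [w] is determined by the height, whose fibers cut the proper
    descendants of [w] into generations. *)
Lemma esum_descendants F w : (forall x, 0 <= F x) ->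
  (forall x, (forall m, iter m.+1 p x <> w) -> F x = 0) ->
  (\esum_(x in [set: X]) (F x)%:E =
   \esum_(m in [set: nat]) (level_sum m.+1 F w)%:E)%E.
Proof.
move=> F0 Foff; have F0e x : (0 <= (F x)%:E)%E by rewrite lee_fin.
pose A := [set x | exists m, iter m.+1 p x = w].
transitivity (\esum_(x in A) (F x)%:E)%E.
  rewrite [RHS]esum_mkcond; apply: eq_esum => x _; case: ifPn => // xA.
  rewrite Foff// => m xm; move/negP: xA; apply; apply/mem_set.
  by exists m.
rewrite (esum_fibers (g := fun x => absz (h x - h w - 1)%R) (B := setT))//.
apply: eq_esum => m _; rewrite -esum_level//.
congr esum; apply/seteqP; split=> x.
  move=> [[k xk] /= xm]; rewrite -[LHS]/(iter m.+1 p x).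
  have := height_descendant xk => hx; have -> : m = k by move: xm; rewrite hx; lia.
  exact: xk.
move=> xm; split; first by exists m.
by have := height_descendant (m := m.+1) xm => /= ->; lia.
Qed.

Lemma real_sum_descendants F w : abs_summable F ->
  (forall x, (forall m, iter m.+1 p x <> w) -> F x = 0) ->
  series (fun m => level_sum m.+1 F w) @ \oo --> real_sum F.
Proof.
move=> sF Foff.
pose Fp x := Num.max (F x) 0; pose Fn x := Num.max (- F x) 0.
have part (G : X -> R) : (forall x, 0 <= G x) -> (forall x, G x <= `|F x|) ->
    series (fun m => level_sum m.+1 G w) @ \oo -->
      fine (\esum_(x in [set: X]) (G x)%:E)%E.
  move=> G0 GF; have Goff x : (forall m, iter m.+1 p x <> w) -> G x = 0.
    by move=> /Foff Fx; apply/eqP; rewrite eq_le G0 -(normr0 R) -Fx GF.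
  have sG := esum_lty_le GF sF.
  have E := esum_descendants G0 Goff; rewrite E in sG *.
  by apply: nonneg_series_cvg => // m; exact: level_sum_ge0.
have -> : series (fun m => level_sum m.+1 F w) =
    (fun n => series (fun m => level_sum m.+1 Fp w) n
            - series (fun m => level_sum m.+1 Fn w) n).
  apply/funext => n; rewrite /series -sumrB; apply: eq_bigr => m _.
  rewrite -level_sum_sub; congr level_sum; apply/funext => x.
  exact: pos_neg_part.
apply: cvgB; apply: part => x; rewrite ?max0_ge0//.
- exact: pos_part_le.
- exact: neg_part_le.
Qed.

(** * The weights and the constants $b_n$, $d_{n,k}$ *)

Variable alpha : R.
Hypothesis alpha_gt1 : 1 < alpha.

Definition weight (k : int) : R := q%:R `^ (- (alpha * k%:~R)).
Local Notation t := (q%:R `^ (- alpha)).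
Local Notation B := (limn (series (fun l : nat =>
  q%:R `^ (- (alpha * l.+1%:R)) * inv_geo q l * geo q l.+1))).

Let qR := @q_ge2R R q q_ge2.
Let q0 := @q_gt0R R q q_ge2.

Lemma weight_gt0 k : 0 < weight k.
Proof. by rewrite powR_gt0. Qed.

Lemma weight_ge0 k : 0 <= weight k.
Proof. exact: powR_ge0. Qed.

Lemma weighted_sqr_ge0 c a k : 0 <= c -> 0 <= c * a ^+ 2 * weight k.
Proof.
move=> c0; apply: mulr_ge0; last exact: weight_ge0.
by apply: mulr_ge0; rewrite ?sqr_ge0.
Qed.

Lemma ratio_gt0 : 0 < t.
Proof. by rewrite powR_gt0. Qed.

Lemma qratio_lt1 : q%:R * t < 1.
Proof.
rewrite -{1}(powRr1 (ltW q0)) -powRD; last by apply/implyP => _; rewrite gt_eqF.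
rewrite -opprB powRN invf_lt1 ?powR_gt0//.
have := @gt0_ltr_powR R (alpha - 1) _ 1 q%:R.
rewrite powR1; apply; rewrite ?subr_gt0// ?nnegrE ?ler0n//.
by have := qR; lra.
Qed.

Lemma powR_ratio n : q%:R `^ (- (alpha * n%:R)) = t ^+ n.
Proof. by rewrite -mulNr powRrM powR_mulrn// powR_ge0. Qed.

Lemma weight_add k n : weight (k + n%:Z) = weight k * t ^+ n.
Proof.
rewrite /weight -powR_ratio -powRD; last by apply/implyP => _; rewrite gt_eqF.
by congr powR; rewrite intrD; ring.
Qed.

(** The general term of the series defining $b_0$ is dominated by a geometric
    one of ratio $q^{1-\alpha} < 1$. *)
Lemma bterm_bound l :
  0 <= q%:R `^ (- (alpha * l.+1%:R)) * inv_geo q l * geo q l.+1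
    <= (2 * (q%:R * t)) * (q%:R * t) ^+ l.
Proof.
have i0 : 0 <= inv_geo q l :> R by rewrite (le_trans ler01)// inv_geo_ge1.
have t0 : 0 <= t ^+ l.+1 by rewrite exprn_ge0// powR_ge0.
rewrite powR_ratio; apply/andP; split.
  by rewrite !mulr_ge0 ?geo_ge0.
have -> : 2 * (q%:R * t) * (q%:R * t) ^+ l = t ^+ l.+1 * (2 * q%:R ^+ l.+1).
  by rewrite exprMn !exprS; ring.
rewrite -mulrA ler_wpM2l//; apply: ler_pM => //.
- exact: geo_ge0.
- exact: inv_geo_le2.
- exact: geo_le.
Qed.

Lemma qratio01 : 0 <= q%:R * t < 1.
Proof. by rewrite qratio_lt1 andbT mulr_ge0 ?powR_ge0// ltW. Qed.

Lemma bterm_cvg : series (fun l : nat =>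
  q%:R `^ (- (alpha * l.+1%:R)) * inv_geo q l * geo q l.+1) @ \oo --> B.
Proof.
apply: (@cvgP _ _ _ _); apply: abs_summable_series_cvg.
apply: (abs_summable_geometric qratio01) => n.
by have /andP[b0 b1] := bterm_bound n; rewrite ger0_norm//; exact: b1.
Qed.

Lemma bseries_gt0 : 0 < B.
Proof.
apply: (@lt_le_trans _ _ (series (fun l : nat =>
  q%:R `^ (- (alpha * l.+1%:R)) * inv_geo q l * geo q l.+1) 1%N)).
  rewrite /series /= big_nat1 powR_ratio inv_geo0 geoS geo0 expr0 add0r !mulr1.
  by rewrite expr1 ratio_gt0.
apply: nondecreasing_cvgn_le; last exact: bterm_cvg.
by apply: nondecreasing_series => l _ _; case/andP: (bterm_bound l).
Qed.

Lemma bcoefE k : bcoef q alpha k = weight k * B.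
Proof. by []. Qed.

Lemma dcoefE n k :
  dcoef q alpha n k = inv_geo q n * (weight k * B)^-1 * t ^+ n.+1.
Proof.
rewrite /dcoef bcoefE -/(inv_geo q n) -mulrA; congr (_ * _).
have -> : weight k = weight (k - n%:Z - 1) * t ^+ n.+1.
  by rewrite -weight_add; congr weight; lia.
have Wn0 := gt_eqF (weight_gt0 (k - n%:Z - 1)).
have Bn0 := gt_eqF bseries_gt0.
have tn0 : t ^+ n.+1 != 0 by rewrite expf_neq0// gt_eqF// ratio_gt0.
by field; rewrite tn0 Wn0 Bn0.
Qed.

Lemma dcoef_ge0 n k : 0 <= dcoef q alpha n k.
Proof.
rewrite dcoefE !mulr_ge0// ?(le_trans ler01 (inv_geo_ge1 _ _))//.
  by rewrite invr_ge0 mulr_ge0 ?ltW// ?weight_gt0 ?bseries_gt0.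
Qed.

Lemma dcoef_le n k : dcoef q alpha n k <= 2 * (weight k * B)^-1 * t ^+ n.+1.
Proof.
rewrite dcoefE -mulrA -[leRHS]mulrA ler_wpM2r ?inv_geo_le2//.
rewrite mulr_ge0// ?invr_ge0 ?mulr_ge0 ?exprn_ge0 ?powR_ge0//.
by rewrite ltW ?bseries_gt0.
Qed.

(** * The functions $\Gamma^H_{n,v}$ *)

(** The value of $\Gamma_{n,v}$ at the child [z] of $p^{n+1}(v)$: it is
    $(q-1)/q$ at $p^n(v)$ and $-1/q$ at the other children. *)
Definition branch_coef n v z : R := (z == iter n p v)%:R - q%:R^-1.

(** Closed form of $\Gamma^H_{n,v}$.  When $h(x) \le h(w)$ the absolute value
    is not the depth of [x] below [w], but then the test fails, since the
    index drops by one at each step towards $\omega$. *)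
Definition Gamma_ext n v x : R :=
  let w := iter n.+1 p v in
  let m := absz (h x - h w - 1)%R in
  if iter m.+1 p x == w then inv_geo q m * branch_coef n v (iter m p x) else 0.

Lemma Gamma_ext_desc n v m x : iter m.+1 p x = iter n.+1 p v ->
  Gamma_ext n v x = inv_geo q m * branch_coef n v (iter m p x).
Proof.
move=> xv; rewrite /Gamma_ext (height_descendant xv).
rewrite (_ : absz _ = m); last by lia.
by rewrite xv eqxx.
Qed.

Lemma Gamma_ext_off n v x : (forall m, iter m.+1 p x <> iter n.+1 p v) ->
  Gamma_ext n v x = 0.
Proof. by move=> xv; rewrite /Gamma_ext; case: eqP => // /xv. Qed.

Lemma branch_coef_le1 n v z : `|branch_coef n v z| <= 1.
Proof.
have qi0 : 0 < q%:R^-1 :> R by rewrite invr_gt0.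
have qi1 : q%:R^-1 <= 1 :> R by rewrite invf_le1//; have := qR; lra.
by rewrite /branch_coef ler_norml; case: eqP => _ /=; apply/andP; split; lra.
Qed.

Lemma Gamma_ext_le2 n v x : `|Gamma_ext n v x| <= 2.
Proof.
rewrite /Gamma_ext; case: ifP => _; last by rewrite normr0.
rewrite normrM -[leRHS]mulr1 ler_pM ?branch_coef_le1//.
by rewrite ger0_norm ?inv_geo_le2// (le_trans ler01)// inv_geo_ge1.
Qed.

Lemma sum_branch_coef_mul n v a :
  \sum_(z <- ch (iter n.+1 p v)) branch_coef n v z * a z =
  a (iter n p v) - q%:R^-1 * \sum_(z <- ch (iter n.+1 p v)) a z.
Proof.
rewrite mulr_sumr; under eq_bigr do rewrite mulrBl.
rewrite sumrB; congr (_ - _).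
rewrite (bigD1_seq (iter n p v))//=; last by rewrite mem_ch.
rewrite eqxx mul1r big1 ?addr0// => z /negbTE ->.
by rewrite mul0r.
Qed.

Lemma sum_branch_coef n v : \sum_(z <- ch (iter n.+1 p v)) branch_coef n v z = 0.
Proof.
have := sum_branch_coef_mul n v (fun=> 1); under eq_bigr do rewrite mulr1.
by move=> ->; rewrite sum_ch_const mulr1 mulVf ?subrr// gt_eqF.
Qed.

(** Three cases: below $w = p^{n+1}(v)$ the recurrence of [inv_geo] applies, at
    [w] the values on the children cancel, and elsewhere everything is 0. *)
Lemma Gamma_ext_harmonic n v : tree_harmonic (Gamma_ext n v).
Proof.
move=> x; set w := iter n.+1 p v.
have hw m : iter m.+1 p w <> w by move=> /height_descendant; lia.
have [[m xm]|xw] := pselect (exists m, iter m.+1 p x = w).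
  have -> : \sum_(y <- ch x) Gamma_ext n v y =
      q%:R * (inv_geo q m.+1 * branch_coef n v (iter m p x)).
    rewrite -(sum_ch_const _ x) big_seq [RHS]big_seq.
    apply: eq_bigr => y; rewrite mem_ch => /eqP yx.
    have ym : iter m.+2 p y = w by rewrite iterSr yx.
    by rewrite (Gamma_ext_desc ym) iterSr yx.
  rewrite (Gamma_ext_desc xm).
  have -> : Gamma_ext n v (p x) =
      q%:R * (inv_geo q m - 1) * branch_coef n v (iter m p x).
    case: m xm => [|m] xm.
      rewrite inv_geo0 subrr mulr0 mul0r; apply: Gamma_ext_off => k.
      by rewrite (xm : p x = w); exact: hw.
    rewrite (Gamma_ext_desc (m := m)); last by rewrite -iterSr.
    rewrite -iterSr inv_geoS; congr (_ * _).
    by field; rewrite gt_eqF.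
  by rewrite inv_geoS; field; rewrite gt_eqF.
have offx : Gamma_ext n v x = 0 by apply: Gamma_ext_off => m xm; apply: xw; exists m.
have offpx : Gamma_ext n v (p x) = 0.
  by apply: Gamma_ext_off => m xm; apply: xw; exists m.+1; rewrite iterSr.
rewrite offx offpx mulr0 add0r.
have [->|xnw] := eqVneq x w.
  rewrite -[LHS](sum_branch_coef n v) -/w big_seq [RHS]big_seq.
  apply: eq_bigr => y; rewrite mem_ch => /eqP yw.
  by rewrite (Gamma_ext_desc (m := 0%N))//= inv_geo0 mul1r.
rewrite big_seq big1// => y; rewrite mem_ch => /eqP yx.
apply: Gamma_ext_off => -[|m]; first by rewrite /= yx; exact/eqP.
by rewrite iterSr yx => xm; apply: xw; exists m.
Qed.

Lemma weight_descendant n v x m : iter m p x = iter n.+1 p v ->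
  weight (h x) = weight (h (iter n.+1 p v)) * t ^+ m.
Proof. by move=> /height_descendant ->; rewrite weight_add. Qed.

Lemma weight_ancestor n v : weight (h v) = weight (h (iter n p v)) * t ^+ n.
Proof. by rewrite -weight_add height_iter; congr weight; lia. Qed.

(** Each of the $q^{m+1}$ descendants of $w$ at depth $m+1$ contributes at most
    $4 q^{-\alpha(h(w)+m+1)}$.  The factor [c] stands inside because sums in the
    extended reals are easier to bound than to rescale. *)
Lemma Gamma_ext_energy c n v : 0 <= c ->
  (\esum_(x in [set: X]) (c * Gamma_ext n v x ^+ 2 * weight (h x))%:E <=
   (c * weight (h (iter n.+1 p v)) * (4 * (q%:R * t) / (1 - q%:R * t)))%:E)%E.
Proof.
move=> c0; set w := iter n.+1 p v.
have F0 x : 0 <= c * Gamma_ext n v x ^+ 2 * weight (h x).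
  by rewrite weighted_sqr_ge0.
rewrite (@esum_descendants _ w)// => [|x xw]; last first.
  by rewrite (Gamma_ext_off xw) expr2 !(mul0r, mulr0).
rewrite (_ : c * weight (h w) * _ =
    c * weight (h w) * (4 * (q%:R * t)) / (1 - q%:R * t));
  last by rewrite [LHS]mulrA.
apply: (esum_geometric_le qratio01) => m; rewrite level_sum_ge0//=.
have level z : z \in ch w ->
    level_sum m (fun x => c * Gamma_ext n v x ^+ 2 * weight (h x)) z
    <= c * 4 * weight (h w) * t ^+ m.+1 * q%:R ^+ m.
  rewrite mem_ch => /eqP zw.
  rewrite (@level_sum_eqM _ _ (fun=> 1)
    (c * (inv_geo q m * branch_coef n v z) ^+ 2 * (weight (h w) * t ^+ m.+1)) z).
    rewrite level_sum_const mulr1 ler_wpM2r ?exprn_ge0 ?ler0n//.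
    rewrite -[leRHS]mulrA ler_wpM2r//.
      by rewrite mulr_ge0 ?exprn_ge0 ?powR_ge0.
    rewrite ler_wpM2l// -real_normK ?num_real// (_ : 4 = 2 ^+ 2); last by ring.
    rewrite ler_sqr ?nnegrE// normrM -[leRHS]mulr1 ler_pM ?branch_coef_le1//.
    by rewrite ger0_norm ?inv_geo_le2// (le_trans ler01)// inv_geo_ge1.
  move=> x xz; have xw : iter m.+1 p x = w by rewrite iterS xz.
  by rewrite (Gamma_ext_desc xw) (weight_descendant xw) xz mulr1.
apply: (@le_trans _ _ (\sum_(z <- ch w)
    c * 4 * weight (h w) * t ^+ m.+1 * q%:R ^+ m)).
  by rewrite big_seq [leRHS]big_seq; apply: ler_sum => z; exact: level.
rewrite sum_ch_const exprMn exprS le_eqVlt; apply/orP; left; apply/eqP; ring.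
Qed.

(** The first factor is the general term of the series defining $b_0$.  The
    value [u w] cancels because the coefficients [branch_coef] sum to 0. *)
Lemma level_sum_mul_Gamma_ext u d n v m : tree_harmonic u ->
  let w := iter n.+1 p v in
  level_sum m.+1 (fun x => u x * (d * Gamma_ext n v x) * weight (h x)) w =
  (q%:R `^ (- (alpha * m.+1%:R)) * inv_geo q m * geo q m.+1) *
  (d * weight (h w) * (u (iter n p v) - q%:R^-1 * \sum_(z <- ch w) u z)).
Proof.
move=> hu w /=.
transitivity (\sum_(z <- ch w) d * weight (h w) * t ^+ m.+1 * inv_geo q m *
    (branch_coef n v z * (geo q m.+1 * u z - geo q m * u w))).
  rewrite big_seq [RHS]big_seq; apply: eq_bigr => z; rewrite mem_ch => /eqP zw.
  rewrite (@level_sum_eqM _ _ u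
    (d * weight (h w) * t ^+ m.+1 * inv_geo q m * branch_coef n v z)).
    by rewrite level_sum_harmonic// zw -!mulrA.
  move=> x xz; have xw : iter m.+1 p x = w by rewrite iterS xz.
  by rewrite (Gamma_ext_desc xw) (weight_descendant xw) xz; ring.
rewrite -mulr_sumr (sum_branch_coef_mul n v (fun z => geo q m.+1 * u z - geo q m * u w)).
rewrite sumrB sum_ch_const -mulr_sumr powR_ratio.
by field; rewrite gt_eqF.
Qed.

(** * The reproducing kernel among real functions *)

(** The bracket is $\delta_n - \delta_{n+1}/q$ once the sum over the children
    of $p^{n+1}(v)$ is eliminated by harmonicity. *)
Lemma telescoping (a : nat -> R) n :
  \sum_(0 <= k < n) inv_geo q k *
     (a k - q%:R^-1 * ((q%:R + 1) * a k.+1 - a k.+2)) =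
  a 0%N - a n - (inv_geo q n - 1) * (a n - a n.+1).
Proof.
elim: n => [|n IH]; first by rewrite big_nil inv_geo0; ring.
by rewrite big_nat_recr//= IH inv_geoS; field; rewrite gt_eqF.
Qed.

Lemma ratio_lt_half : 2 * t < 1.
Proof.
by apply: le_lt_trans qratio_lt1; rewrite ler_wpM2r ?powR_ge0.
Qed.

Definition sqr_summable u : Prop :=
  (\esum_(x in [set: X]) (u x ^+ 2 * weight (h x))%:E < +oo)%E.

(** One term of the convergent sum gives $u(p^n(v))^2 \le C q^{-\alpha n}$. *)
Lemma sqr_summable_iter_cvg0 u v : sqr_summable u ->
  (fun n => u (iter n p v)) @ \oo --> 0.
Proof.
move=> su; set M := (\esum_(x in [set: X]) (u x ^+ 2 * weight (h x))%:E)%E in su.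
have uW0 x : 0 <= u x ^+ 2 * weight (h x) by rewrite -[_ ^+ 2]mul1r weighted_sqr_ge0.
have Mfin : M \is a fin_num by rewrite ge0_fin_numE// esumT_ge0.
have bound n : u (iter n p v) ^+ 2 <= geometric (fine M / weight (h v)) t n.
  have : ((u (iter n p v) ^+ 2 * weight (h (iter n p v)))%:E <= M)%E.
    by apply: (esum_ge_term (a := fun x => (u x ^+ 2 * weight (h x))%:E)) => x;
      rewrite lee_fin.
  rewrite -(fineK Mfin) lee_fin => uM.
  rewrite /geometric /= mulrAC ler_pdivlMr ?weight_gt0// {1}(weight_ancestor n v) mulrA.
  by rewrite ler_wpM2r// exprn_ge0// powR_ge0.
have sq0 : (fun n => u (iter n p v) ^+ 2) @ \oo --> 0.
  apply: (squeeze_cvgr (f := fun=> 0)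
    (h := geometric (fine M / weight (h v)) t)); last 2 first.
  - exact: cvg_cst.
  - apply: cvg_geometric; rewrite ger0_norm ?powR_ge0//.
    by have := ratio_lt_half; have := ratio_gt0; lra.
  by apply: nearW => n; rewrite sqr_ge0 bound.
apply/cvgrPdist_lt => eps eps0.
have /cvgrPdist_lt/(_ (eps ^+ 2)) := sq0.
rewrite exprn_gt0// => /(_ isT); apply: filterS => n.
rewrite !sub0r !normrN normrX ltr_sqr ?nnegrE//.
exact: ltW.
Qed.

Definition kernel_term v n x : R := dcoef q alpha n (h v) * Gamma_ext n v x.

Definition bergman_kernel v x : R := real_sum (fun n => kernel_term v n x).

Let t01 : 0 <= t < 1.
Proof.
by rewrite powR_ge0/=; have := ratio_lt_half; have := ratio_gt0; lra.
Qed.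

Lemma kernel_term_summable v x : abs_summable (fun n => kernel_term v n x).
Proof.
apply: (abs_summable_geometric (c := 4 * (weight (h v) * B)^-1 * t) t01) => n.
rewrite normrM ger0_norm ?dcoef_ge0//.
apply: (le_trans (ler_pM (dcoef_ge0 _ _) (normr_ge0 _) (dcoef_le _ _) (Gamma_ext_le2 _ _ _))).
by rewrite exprS le_eqVlt; apply/orP; left; apply/eqP; ring.
Qed.

Lemma kernel_cvg v x :
  series (fun n => kernel_term v n x) @ \oo --> bergman_kernel v x.
Proof. exact/abs_summable_series_cvg/kernel_term_summable. Qed.

Lemma kernel_harmonic v : tree_harmonic (bergman_kernel v).
Proof.
move=> x.
have cl : (fun N => (q%:R + 1) * series (fun n => kernel_term v n x) N) @ \oo
    --> (q%:R + 1) * bergman_kernel v x.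
  by apply: cvgMr; exact: kernel_cvg.
have cr : (fun N => series (fun n => kernel_term v n (p x)) N
    + \sum_(y <- ch x) series (fun n => kernel_term v n y) N) @ \oo
    --> bergman_kernel v (p x) + \sum_(y <- ch x) bergman_kernel v y.
  apply: cvgD; first exact: kernel_cvg.
  elim: (ch x) => [|y s IH].
    by rewrite big_nil; under eq_fun do rewrite big_nil; exact: cvg_cst.
  rewrite big_cons; under eq_fun do rewrite big_cons.
  by apply: cvgD => //; exact: kernel_cvg.
suff E : (fun N => (q%:R + 1) * series (fun n => kernel_term v n x) N) =
    (fun N => series (fun n => kernel_term v n (p x)) N
      + \sum_(y <- ch x) series (fun n => kernel_term v n y) N).
  by rewrite E in cl; exact: (cvg_unique _ cl cr).
apply/funext => N; rewrite /series /= exchange_big /= -big_split /= mulr_sumr.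
apply: eq_bigr => n _; rewrite /kernel_term mulrCA Gamma_ext_harmonic mulrDr.
by rewrite mulr_sumr.
Qed.

(** By [dcoef_le] and [Gamma_ext_energy] the inner sum is
    $O(2^n q^{-2\alpha n} q^{\alpha n}) = O((2q^{-\alpha})^n)$. *)
Lemma kernel_energy v :
  (\esum_(n in [set: nat]) \esum_(x in [set: X])
    (2 ^+ n.+1 * kernel_term v n x ^+ 2 * weight (h x))%:E < +oo)%E.
Proof.
set rho := 4 * (q%:R * t) / (1 - q%:R * t).
have rho0 : 0 <= rho.
  have /andP[qt0 qt1] := qratio01.
  by rewrite divr_ge0 ?mulr_ge0 ?subr_ge0 ?ltW// ?ratio_gt0.
pose c := 4 * (weight (h v) * B)^-1 ^+ 2 * weight (h v) * rho * (2 * t).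
have t2 : 0 <= 2 * t < 1 by rewrite ratio_lt_half andbT mulr_ge0 ?powR_ge0.
apply: (@le_lt_trans _ _ (\esum_(n in [set: nat]) (c * (2 * t) ^+ n)%:E)%E).
  apply: le_esum => n _.
  pose d := dcoef q alpha n (h v).
  have d0 : 0 <= 2 ^+ n.+1 * d ^+ 2 by apply: mulr_ge0; rewrite ?sqr_ge0// exprn_ge0.
  have := Gamma_ext_energy n v d0; rewrite -/rho => G.
  apply: (@le_trans _ _ (2 ^+ n.+1 * d ^+ 2 * weight (h (iter n.+1 p v)) * rho)%:E).
    apply: le_trans G; apply: le_esum => x _.
    by rewrite lee_fin /kernel_term exprMn mulrA.
  rewrite lee_fin.
  have Ww0 : 0 <= weight (h (iter n.+1 p v)) * rho by rewrite mulr_ge0 ?weight_ge0.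
  have Wv := weight_ancestor n.+1 v.
  have d2 : d ^+ 2 <= (2 * (weight (h v) * B)^-1 * t ^+ n.+1) ^+ 2.
    rewrite ler_sqr ?nnegrE ?dcoef_ge0 ?dcoef_le//.
    exact: le_trans (dcoef_ge0 n (h v)) (dcoef_le n (h v)).
  apply: (@le_trans _ _ (2 ^+ n.+1 * (2 * (weight (h v) * B)^-1 * t ^+ n.+1) ^+ 2
      * (weight (h (iter n.+1 p v)) * rho))).
    by rewrite -[leLHS]mulrA ler_wpM2r// ler_wpM2l ?exprn_ge0.
  rewrite le_eqVlt; apply/orP; left; apply/eqP.
  rewrite /c; move: (_^-1) => b; rewrite Wv !exprMn !exprS; ring.
apply: (esum_geometric_lty (c := c) t2) => n; rewrite lexx andbT.
have /andP[t20 _] := t2.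
rewrite mulr_ge0 ?exprn_ge0// /c mulr_ge0// mulr_ge0// mulr_ge0 ?weight_ge0//.
rewrite mulr_ge0 ?sqr_ge0//.
Qed.

Lemma kernel_sqr_summable v : sqr_summable (bergman_kernel v).
Proof.
apply: le_lt_trans (kernel_energy v).
rewrite exchange_esum; last first.
  move=> n x; by rewrite lee_fin weighted_sqr_ge0// exprn_ge0.
apply: le_esum => x _; pose s := Num.sqrt (weight (h x)).
have sW : s ^+ 2 = weight (h x) by rewrite sqr_sqrtr// ltW// weight_gt0.
have st := kernel_term_summable v x.
have := sqr_real_sum_le_weighted (abs_summableMr s st).
rewrite real_sumMr// exprMn sW => /le_trans; apply.
by apply: le_esum => n _; rewrite exprMn sW mulrA.
Qed.

(** Young's inequality $ab \le 2^{-n-1}a^2 + 2^{n+1}b^2$ separates [u] from the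
    kernel. *)
Lemma kernel_cross_summable u v : sqr_summable u ->
  (\esum_(n in [set: nat]) \esum_(x in [set: X])
     `|u x * kernel_term v n x * weight (h x)|%:E < +oo)%E.
Proof.
move=> su.
have W0 x : 0 <= weight (h x) := weight_ge0 _.
pose P n x := 2 ^- n.+1 * (u x ^+ 2 * weight (h x)).
pose Q n x := 2 ^+ n.+1 * kernel_term v n x ^+ 2 * weight (h x).
have P0 n x : 0 <= P n x.
  by rewrite /P mulrA weighted_sqr_ge0// invr_ge0 exprn_ge0.
have Q0 n x : 0 <= Q n x by rewrite /Q weighted_sqr_ge0// exprn_ge0.
apply: (@le_lt_trans _ _ (\esum_(n in [set: nat])
    (\esum_(x in [set: X]) (P n x)%:E + \esum_(x in [set: X]) (Q n x)%:E))%E).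
  apply: le_esum => n _; rewrite -esumD; try by move=> x _; rewrite lee_fin.
  apply: le_esum => x _; rewrite -EFinD lee_fin /P /Q.
  rewrite normrM (ger0_norm (W0 x)) [2 ^- _ * _]mulrA -mulrDl.
  rewrite ler_wpM2r// normrM.
  have p0 : 0 < 2 ^+ n.+1 :> R by rewrite exprn_gt0.
  rewrite -(real_normK (num_real (u x))).
  rewrite -(real_normK (num_real (kernel_term v n x))).
  move: `|u x| `|kernel_term v n x| (2 ^+ n.+1) p0 => a b c c0.
  rewrite -(ler_pM2l c0) [leRHS](_ : _ = a ^+ 2 + (c * b) ^+ 2); last first.
    by field; rewrite gt_eqF.
  have := sqr_ge0 (a - c * b); have := sqr_ge0 a; have := sqr_ge0 (c * b); lra.
rewrite esumD; try by move=> n _; exact: esumT_ge0.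
rewrite lte_add_pinfty//; last exact: kernel_energy.
rewrite exchange_esum; last by move=> n x; rewrite lee_fin.
apply: le_lt_trans su; apply: le_esum => x _.
(* $\sum_n 2^{-n-1} = 1$, so the first part is the squared norm of [u]. *)
have half : 0 <= (2^-1 : R) < 1 by lra.
have := @esum_geometric_le R (P^~ x) (2^-1 * (u x ^+ 2 * weight (h x))) 2^-1 half.
rewrite (_ : _ / (1 - 2^-1) = u x ^+ 2 * weight (h x)); last by field.
apply => n; rewrite P0 /P /= exprS invfM exprVn.
by rewrite le_eqVlt; apply/orP; left; apply/eqP; ring.
Qed.

Lemma kernel_reproducing u v : tree_harmonic u -> sqr_summable u ->
  real_sum (fun x => u x * bergman_kernel v x * weight (h x)) = u v.
Proof.
move=> hu su; have cross := kernel_cross_summable v su.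
have -> : (fun x => u x * bergman_kernel v x * weight (h x)) =
    (fun x => real_sum (fun n => u x * kernel_term v n x * weight (h x))).
  apply/funext => x.
  rewrite -mulrA mulrCA -(real_sumMr _ (kernel_term_summable v x)).
  by congr real_sum; apply/funext => n; rewrite -mulrA mulrCA.
rewrite -(real_sum_exchange cross).
pose a n := u (iter n p v).
have inner n : real_sum (fun x => u x * kernel_term v n x * weight (h x)) =
    inv_geo q n * (a n - q%:R^-1 * ((q%:R + 1) * a n.+1 - a n.+2)).
  set w := iter n.+1 p v.
  have sF : abs_summable (fun x => u x * kernel_term v n x * weight (h x)).
    apply: le_lt_trans cross.
    apply: (esum_ge_term (a := fun n => \esum_(x in [set: X])
      `|u x * kernel_term v n x * weight (h x)|%:E)%E) => k.
    exact: esumT_ge0.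
  have off x : (forall m, iter m.+1 p x <> w) ->
      u x * kernel_term v n x * weight (h x) = 0.
    by move=> /Gamma_ext_off; rewrite /kernel_term => ->; rewrite !(mulr0, mul0r).
  pose c := dcoef q alpha n (h v) * weight (h w) *
    (u (iter n p v) - q%:R^-1 * \sum_(z <- ch w) u z).
  have cB : B * c =
      inv_geo q n * (a n - q%:R^-1 * ((q%:R + 1) * a n.+1 - a n.+2)).
    have -> : (q%:R + 1) * a n.+1 - a n.+2 = \sum_(z <- ch w) u z.
      by rewrite /a hu; ring.
    rewrite /c -/(a n) !mulrA; congr (_ * _).
    rewrite /dcoef bcoefE -/(inv_geo q n).
    have -> : h v - n%:Z - 1 = h w by rewrite height_iter; lia.
    by field; rewrite !gt_eqF ?weight_gt0 ?bseries_gt0.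
  rewrite -cB; have lim1 := real_sum_descendants sF off.
  have lim2 : series (fun m =>
      level_sum m.+1 (fun x => u x * kernel_term v n x * weight (h x)) w) @ \oo
      --> B * c.
    have -> : series (fun m =>
        level_sum m.+1 (fun x => u x * kernel_term v n x * weight (h x)) w) =
      (fun N => series (fun l : nat =>
        q%:R `^ (- (alpha * l.+1%:R)) * inv_geo q l * geo q l.+1) N * c).
      apply/funext => N; rewrite /series /= mulr_suml.
      by apply: eq_bigr => m _; exact: (level_sum_mul_Gamma_ext _ n v m hu).
    by apply: cvgMl; exact: bterm_cvg.
  exact: (cvg_unique _ lim1 lim2).
apply: real_sum_lim; first exact: abs_summable_real_sum cross.
have -> : series (fun n => real_sum
      (fun x => u x * kernel_term v n x * weight (h x))) =
    (fun n => a 0%N - a n - (inv_geo q n - 1) * (a n - a n.+1)).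
  apply/funext => n; rewrite /series /= -telescoping.
  by apply: eq_bigr => k _; exact: inner.
have a0 : a @ \oo --> 0 := sqr_summable_iter_cvg0 v su.
have a1 : (fun n => a n.+1) @ \oo --> 0.
  have := sqr_summable_iter_cvg0 (p v) su.
  by under eq_fun do rewrite -iterSr.
have -> : u v = a 0%N - 0 - 0 by rewrite !subr0.
apply: cvgB; first by apply: cvgB => //; exact: cvg_cst.
have b0 : (fun n => a n - a n.+1) @ \oo --> 0.
  suff: (fun n => a n - a n.+1) @ \oo --> (0 - 0 : R) by rewrite subr0.
  exact: cvgB.
apply: norm_cvg0.
apply: (squeeze_cvgr (f := fun=> 0) (h := fun n => `|a n - a n.+1|)).
- apply: nearW => n; rewrite normr_ge0 normrM ler_piMl//.
  have g1 := inv_geo_ge1 q n (R := R); have g2 := inv_geo_le2 q_ge2 n (R := R).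
  by rewrite ler_norml; apply/andP; split; lra.
- exact: cvg_cst.
- suff: (fun n => `|a n - a n.+1|) @ \oo --> `|0 : R| by rewrite normr0.
  exact: cvg_norm.
Qed.

End Descent.

(** * Complex harmonic functions *)

Section ComplexParts.
Context {R : realType}.
Implicit Types z : R[i].
Local Open Scope complex_scope.

Lemma Re_realM (c : R) z : complex.Re (c%:C * z) = c * complex.Re z.
Proof. by case: z => a b /=; rewrite mul0r subr0. Qed.

Lemma Im_realM (c : R) z : complex.Im (c%:C * z) = c * complex.Im z.
Proof. by case: z => a b /=; rewrite mul0r addr0. Qed.

Lemma ReD z z' : complex.Re (z + z') = complex.Re z + complex.Re z'.
Proof. by case: z z' => a b []. Qed.

Lemma ImD z z' : complex.Im (z + z') = complex.Im z + complex.Im z'.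
Proof. by case: z z' => a b []. Qed.

Lemma Re_sum I (s : seq I) (F : I -> R[i]) :
  complex.Re (\sum_(x <- s) F x) = \sum_(x <- s) complex.Re (F x).
Proof. by elim: s => [|x s IH]; rewrite ?big_nil// !big_cons ReD IH. Qed.

Lemma Im_sum I (s : seq I) (F : I -> R[i]) :
  complex.Im (\sum_(x <- s) F x) = \sum_(x <- s) complex.Im (F x).
Proof. by elim: s => [|x s IH]; rewrite ?big_nil// !big_cons ImD IH. Qed.

(** A positive complex number has zero imaginary part, so its real part can serve
    as the tolerance for the real sequence. *)
Lemma cvg_real_complex (a : nat -> R) (l : R) : a @ \oo --> l ->
  (fun n => (a n)%:C : R[i]^o) @ \oo --> (l%:C : R[i]^o).
Proof.
move=> al; apply/cvgrPdist_lt => -[e1 e2]; rewrite ltcE /= => /andP[/eqP e20 e10].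
move/cvgrPdist_lt : al => /(_ e1 e10); apply: filterS => n.
rewrite -rmorphB /= normc_def /= expr0n addr0 sqrtr_sqr ltcE /= e20 eqxx.
exact.
Qed.

End ComplexParts.

Section ComplexKernel.
Context {R : realType} {X : choiceType}.
Variables (q : nat) (e : rel X) (omega : set (nat -> X)) (H0 : set X).
(** [p] and [h] are kept abstract: the predecessor and the index are defined by
    choice, and only the following properties of them matter. *)
Variables (p : X -> X) (h : X -> int) (ch : X -> seq X).
Hypothesis pE : predecessor e omega H0 = p.
Hypothesis hE : hindex e omega H0 = h.
Hypothesis hp : forall x, h (p x) = h x - 1.
Hypothesis edge_pE : forall x y, e x y = (y == p x) || (x == p y).
Hypothesis succE : forall x y, successors e omega H0 x y <-> p y = x.
Hypothesis sectE : forall x y, sector omega x y <-> exists n, iter n p y = x.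
Hypothesis ballE : forall n x, horoball e omega H0 n x <-> h x <= n.
Hypothesis ch_uniq : forall x, uniq (ch x).
Hypothesis mem_ch : forall x y, (y \in ch x) = (p y == x).
Variable alpha : R.
Implicit Types f g : X -> R[i].
Local Open Scope complex_scope.

Lemma p_notin_ch x : p x \notin ch x.
Proof.
rewrite mem_ch; apply/eqP => ppx; have := congr1 h ppx.
by rewrite !hp; lia.
Qed.

Lemma sum_neighbours f x :
  \sum_(y \in [set y | e x y]) f y = f (p x) + \sum_(y <- ch x) f y.
Proof.
transitivity (\sum_(y <- p x :: ch x) f y); last by rewrite big_cons.
rewrite [RHS]fsbig_seq; last by rewrite /= p_notin_ch ch_uniq.
apply: eq_fsbigl; apply/seteqP; split=> y /=;
  by rewrite inE mem_ch edge_pE [x == _]eq_sym.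
Qed.

Lemma harmonic_atE f x : harmonic_at q e f x <->
  (q%:R + 1 : R)%:C * f x = f (p x) + \sum_(y <- ch x) f y.
Proof.
have qE : (q%:R + 1 : R)%:C = q.+1%:R by rewrite natr1 rmorph_nat.
have qn0 : q.+1%:R != 0 :> R[i] by rewrite pnatr_eq0.
rewrite /harmonic_at sum_neighbours qE.
split=> [->|<-]; first by rewrite mulrA mulfV// mul1r.
by rewrite mulrA mulVf// mul1r.
Qed.

Lemma harmonic_funE f : harmonic_fun q e f <->
  tree_harmonic q p ch (fun x => complex.Re (f x)) /\
  tree_harmonic q p ch (fun x => complex.Im (f x)).
Proof.
split=> [hf|[hRe hIm] x].
  split=> x; have /harmonic_atE E := hf x.
    by rewrite -Re_realM E ReD Re_sum.
  by rewrite -Im_realM E ImD Im_sum.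
apply/harmonic_atE/eqP; rewrite eq_complex Re_realM Im_realM ReD ImD Re_sum.
by rewrite Im_sum hRe hIm !eqxx.
Qed.

Lemma in_bergmanE f : in_bergman q e omega H0 alpha f <->
  [/\ harmonic_fun q e f,
      sqr_summable q h alpha (fun x => complex.Re (f x)) &
      sqr_summable q h alpha (fun x => complex.Im (f x))].
Proof.
have normE x : (ComplexField.Normc.normc (f x) ^+ 2 *
      bergman_weight q e omega H0 alpha x) =
    complex.Re (f x) ^+ 2 * weight q alpha (h x)
    + complex.Im (f x) ^+ 2 * weight q alpha (h x).
  rewrite /bergman_weight hE -mulrDl; congr (_ * _); case: (f x) => a b /=.
  by rewrite sqr_sqrtr// addr_ge0 ?sqr_ge0.
have W0 (u : X -> R) x : (0 <= (u x ^+ 2 * weight q alpha (h x))%:E)%E.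
  by rewrite lee_fin mulr_ge0 ?sqr_ge0 ?powR_ge0.
have esumE : (\esum_(x in [set: X]) (ComplexField.Normc.normc (f x) ^+ 2 *
      bergman_weight q e omega H0 alpha x)%:E =
    \esum_(x in [set: X]) (complex.Re (f x) ^+ 2 * weight q alpha (h x))%:E +
    \esum_(x in [set: X]) (complex.Im (f x) ^+ 2 * weight q alpha (h x))%:E)%E.
  rewrite -esumD; last 2 first.
  - by move=> x _; exact: (W0 (fun x => complex.Re (f x))).
  - by move=> x _; exact: (W0 (fun x => complex.Im (f x))).
  by apply: eq_esum => x _; rewrite normE EFinD.
rewrite /in_bergman esumE; split=> [[hf s]|[hf sRe sIm]]; last first.
  by split=> //; exact: lte_add_pinfty.
split=> //; apply: le_lt_trans s.
  by rewrite leeDl// esum_ge0// => x _; exact: (W0 (fun x => complex.Im (f x))).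
by rewrite leeDr// esum_ge0// => x _; exact: (W0 (fun x => complex.Re (f x))).
Qed.

Lemma inner_real f (k : X -> R) :
  inner q e omega H0 alpha f (fun x => (k x)%:C) =
  real_sum (fun x => complex.Re (f x) * k x * weight q alpha (h x)) +i*
  real_sum (fun x => complex.Im (f x) * k x * weight q alpha (h x)).
Proof.
have E x : f x * (Num.conj (k x)%:C) *
    (bergman_weight q e omega H0 alpha x)%:C =
    (k x * weight q alpha (h x))%:C * f x.
  rewrite conj_Creal; last by apply/complex_realP; exists (k x).
  by rewrite /bergman_weight hE -mulrA -rmorphM mulrC.
rewrite /inner /complex_sum; congr (_ +i* _);
  by congr real_sum; apply/funext => x; rewrite E ?Re_realM ?Im_realM; ring.
Qed.

Hypothesis q_ge2 : (2 <= q)%N.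
Hypothesis alpha_gt1 : 1 < alpha.

(** On the horoball where the extension leaves $\Gamma_{n,v}$ unchanged, the
    only proper descendants of [w] are its children. *)
Lemma Gamma_top n v y (w := iter n.+1 p v) : h y <= h w + 1 ->
  Gamma q e omega H0 R w (iter n p v) y =
  if p y == w then branch_coef q p n v y else 0.
Proof.
move=> hy.
have punctE x : punctured_sector omega w x <-> exists m, iter m.+1 p x = w.
  rewrite /punctured_sector /= sectE; split.
    by move=> [[[|m] xm] xw]; [case: xw|exists m].
  move=> [m xm]; split; first by exists m.+1.
  move=> xw; have := height_descendant hp (xm : iter m.+1 p x = w).
  by rewrite xw; lia.
have vw : punctured_sector omega w (iter n p v).
  by apply/punctE; exists 0%N.
rewrite /Gamma; case: asboolP => [off|on].
  case: eqP => // yw; exfalso; case: off; first by apply.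
  by apply; apply/punctE; exists 0%N.
have [m ym] : exists m, iter m.+1 p y = w.
  by apply/punctE; apply: contrapT => yw; apply: on; right.
have m0 : m = 0%N by have := height_descendant hp (ym : iter m.+1 p y = w); lia.
rewrite m0 in ym; rewrite (ym : p y = w) eqxx /branch_coef.
case: asboolP => [[z zw [vz yz]]|no].
  move: zw vz yz; rewrite succE.
  rewrite !sectE => zw [a va] [b yb].
  have hz := hp z; rewrite zw in hz.
  have hv : h (iter n p v) - 1 = h w by rewrite -hp.
  have a0 : a = 0%N by have := height_descendant hp va; lia.
  have hy1 : h y - 1 = h w by rewrite -hp; congr h.
  have b0 : b = 0%N by have := height_descendant hp yb; lia.
  rewrite a0 /= in va; rewrite b0 /= in yb; rewrite yb va eqxx.
  by rewrite mulrBl divff ?mul1r// q_neq0.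
rewrite (_ : (y == _) = false) ?sub0r//; apply/eqP => yv; apply: no.
exists y; first exact/succE.
by split; apply/sectE; exists 0%N.
Qed.

Lemma GammaHE n v x :
  GammaH q e omega H0 R n v x = (Gamma_ext q p h n v x)%:C.
Proof.
rewrite /GammaH /hext /Gamma_ext pE hE; set w := iter n.+1 p v.
case: asboolP => [/ballE hx|/ballE hx].
  rewrite Gamma_top//; congr (_%:C).
  have [xw|xw] := eqVneq (p x) w.
    have hxw : h x - 1 = h w by rewrite -hp xw.
    rewrite (_ : absz _ = 0%N); last by lia.
    by rewrite /= xw eqxx inv_geo0 mul1r.
  case: eqP => // xm; have := height_descendant hp xm => hxm.
  have m0 : absz (h x - h w - 1)%R = 0%N by lia.
  by move: xm; rewrite m0 => /eqP; rewrite /= (negbTE xw).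
have hm : h x = h w + 1 + (absz (h x - h w - 1)%R)%:Z by lia.
move: (absz _) hm => m hm.
have hy : h (iter m p x) = h w + 1 by rewrite (height_iter hp) hm; lia.
have hy1 : h (iter m p x) <= h w + 1 by rewrite hy.
have hpy : h (p (iter m p x)) <= h w + 1 by rewrite hp hy; lia.
rewrite !Gamma_top//.
rewrite (_ : p (p (iter m p x)) == w = false); last first.
  by apply/eqP => xw; have := height_descendant hp (xw : iter m.+2 p x = w); lia.
rewrite rmorph0 mulr0 subr0 -rmorphM; congr (_%:C).
by rewrite iterS; case: ifP => _; rewrite ?mulr0.
Qed.

Lemma Kpartial_cvg v x : Kpartial q e omega H0 alpha v x @ \oo -->
  ((bergman_kernel q p h alpha v x)%:C : R[i]^o).
Proof.
have -> : Kpartial q e omega H0 alpha v x =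
    (fun N => (series (fun n => kernel_term q p h alpha v n x) N)%:C : R[i]^o).
  apply/funext => N; rewrite /Kpartial /series /= raddf_sum.
  by apply: eq_bigr => n _; rewrite /Kterm GammaHE hE -rmorphM.
by apply: cvg_real_complex; exact: kernel_cvg.
Qed.

Lemma KalphaE v : Kalpha q e omega H0 alpha v =
  (fun x => (bergman_kernel q p h alpha v x)%:C).
Proof.
apply/funext => x.
exact: (cvg_lim (@norm_hausdorff _ R[i]^o) (@Kpartial_cvg v x)).
Qed.

End ComplexKernel.

Theorem theorem18 (R : realType) (X : choiceType) (q : nat) (e : rel X)
    (omega : set (nat -> X)) (H0 : set X) (alpha : R) :
  (2 <= q)%N ->
  homogeneous_tree q e ->
  boundary_point e omega ->
  is_horocycle e omega H0 ->
  1 < alpha ->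
  forall v : X,
    (forall x : X, cvgn (Kpartial q e omega H0 alpha v x)) /\
    is_kernel q e omega H0 alpha v (Kalpha q e omega H0 alpha v).
Proof.
move=> q_ge2 treeX bdX horX alpha_gt1 v.
have [ch [ch_uniq mem_ch size_ch]] := exists_children treeX bdX horX.
set p := predecessor e omega H0 in mem_ch; set h := hindex e omega H0.
have hp : forall x, h (p x) = h x - 1 := hindex_predecessor treeX bdX horX.
have edge_pE := edge_predecessorE treeX bdX horX.
have ballE := horoballE treeX bdX horX.
have succE := successorsE treeX bdX horX.
have sectE := sectorE treeX bdX horX.
have [pE hE] : predecessor e omega H0 = p /\ hindex e omega H0 = h by [].
rewrite -/p -/h in edge_pE ballE succE sectE.
move: (p) (h) pE hE mem_ch hp edge_pE ballE succE sectE => {}p {}h pE hE.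
move=> mem_ch hp edge_pE ballE succE sectE.
have harmE := @harmonic_funE R _ q _ _ _ _ hp edge_pE ch_uniq mem_ch.
have bergE := in_bergmanE q hE alpha.
have kernelE := KalphaE pE hE hp succE sectE ballE q_ge2 alpha_gt1 v.
have reproducing u := @kernel_reproducing _ _ _ _ _ _
  hp q_ge2 ch_uniq mem_ch size_ch _ alpha_gt1 u v.
split=> [x|].
  have := @Kpartial_cvg _ _ _ _ _ _ _ _ pE hE hp succE sectE ballE _
    q_ge2 alpha_gt1 v x.
  exact: cvgP.
rewrite kernelE; split=> [|f /bergE[/harmE[hRe hIm] sRe sIm]].
  apply/bergE; split.
  - apply/harmE; split; first exact: kernel_harmonic.
    by move=> x; rewrite mulr0 big1// addr0.
  - exact: (kernel_sqr_summable hp q_ge2 ch_uniq mem_ch size_ch).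
  - rewrite /sqr_summable esum1 ?ltry// => x _ /=.
    by rewrite expr0n mul0r.
rewrite (inner_real q hE) !reproducing//.
by case: (f v).
Qed.
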